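(* Let $\mathbf{D}$ be a locally small dagger rig category satisfying axioms (A1)–(A8), (A9$'$) and (A10) listed in the context, let $\mathcal{C}$ be the involutive field of scalars of its scalar localisation $\mathbf{C}$, and let $\mathcal{R}_+\subseteq\mathcal{C}$ be the set of positive scalars. There is an isomorphism of $\mathcal{C}$ with $\mathbb{R}$ or $\mathbb{C}$ that maps $\mathcal{R}_+$ onto $\mathbb{R}_+=\{r\in\mathbb{R}:r\ge0\}$.
   Context: Dagger categories. A dagger on a category is a contravariant endofunctor $(-)^\dagger$ with $X^\dagger=X$ and $f^{\dagger\dagger}=f$. A morphism $f$ is a dagger monomorphism if $f^\dagger f=1$, a dagger epimorphism if $ff^\dagger=1$, a dagger isomorphism if both. A dagger symmetric monoidal category is a symmetric monoidal category with a dagger whose monoidal product is a dagger functor (preserves $\dagger$) and whose symmetry, associator and unitors are dagger isomorphisms. A dagger rig category is a dagger category with dagger symmetric monoidal structures $(\otimes,I)$ and $(\oplus,O)$ and natural dagger isomorphisms $A\otimes(X\oplus Y)\to(A\otimes X)\oplus(A\otimes Y)$, $(X\oplus Y)\otimes A\to(X\otimes A)\oplus(Y\otimes A)$, $X\otimes O\to O$, $O\otimes X\to O$, satisfying Laplaza's coherence conditions for rig (symmetric bimonoidal) categories, which amount to the following. Write $\alpha,\lambda,\rho,\sigma$ for the associator $(A\otimes B)\otimes C\to A\otimes(B\otimes C)$, left unitor $I\otimes A\to A$, right unitor $A\otimes I\to A$ and symmetry of $\otimes$, write $\alpha',\lambda',\rho',\sigma'$ for those of $\oplus$, write $\delta_{A,X,Y},\varepsilon_{X,Y,A},\xi_X,\zeta_X$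 for the four isomorphisms just listed, in that order, and write $\tau_{W,X,Y,Z}\colon(W\oplus X)\oplus(Y\oplus Z)\to(W\oplus Y)\oplus(X\oplus Z)$ for the canonical interchange isomorphism built from $\alpha'$ and $\sigma'$. Then, for all objects $A,B,C,D$ (abbreviating $A\otimes B$ to $AB$): $\sigma'_{AB,AC}\,\delta_{A,B,C}=\delta_{A,C,B}(1_A\otimes\sigma'_{B,C})$; $(\sigma_{A,C}\oplus\sigma_{B,C})\varepsilon_{A,B,C}=\delta_{C,A,B}\,\sigma_{A\oplus B,C}$; $\alpha'_{AB,AC,AD}(\delta_{A,B,C}\oplus1_{AD})\delta_{A,B\oplus C,D}=(1_{AB}\oplus\delta_{A,C,D})\delta_{A,B,C\oplus D}(1_A\otimes\alpha'_{B,C,D})$; $\delta_{A,BC,BD}(1_A\otimes\delta_{B,C,D})\alpha_{A,B,C\oplus D}=(\alpha_{A,B,C}\oplus\alpha_{A,B,D})\delta_{AB,C,D}$; $\tau_{AC,BC,AD,BD}(\varepsilon_{A,B,C}\oplus\varepsilon_{A,B,D})\delta_{A\oplus B,C,D}=(\delta_{A,C,D}\oplus\delta_{B,C,D})\varepsilon_{A,B,C\oplus D}$; $\zeta_O=\xi_O$; $\zeta_{A\oplus B}=\lambda'_O(\zeta_A\oplus\zeta_B)\delta_{O,A,B}$; $\zeta_I=\rho_O$; $\xi_A\,\sigma_{O,A}=\zeta_A$; $\zeta_{AB}\,\alpha_{O,A,B}=\zeta_B(\zeta_A\otimes1_B)$; $\lambda'_{AB}(\xi_A\oplus1_{AB})\delta_{A,O,B}=1_A\otimes\lambda'_B$;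 $(\lambda_A\oplus\lambda_B)\delta_{I,A,B}=\lambda_{A\oplus B}$ (the remaining conditions on Laplaza's list follow from these). Axioms. (A1) $O$ is terminal (hence a zero object; write $0$ for zero morphisms, $i_1\colon X\cong X\oplus O\xrightarrow{1\oplus0}X\oplus Y$, $i_2\colon Y\cong O\oplus Y\xrightarrow{0\oplus1}X\oplus Y$, $p_k=i_k^\dagger$). (A2) $i_1,i_2$ are jointly epic. (A3) There is $d\colon I\to I\oplus I$ with $i_1^\dagger d\ne0\ne i_2^\dagger d$. (A4) Exactly two subobjects of $I$ have a dagger monic representative. (A5) If $f,g\colon X\otimes Y\to Z$ satisfy $f(x\otimes y)=g(x\otimes y)$ for all $x\colon I\to X$, $y\colon I\to Y$, then $f=g$. (A6) Every parallel pair has an equaliser that is a dagger monomorphism. (A7) Every dagger monomorphism is a kernel. (A8) For all epimorphisms $x\colon A\to X$, $y\colon A\to Y$: $x^\dagger x=y^\dagger y$ if and only if $y=fx$ for some isomorphism $f\colon X\to Y$. (A9$'$) Every sequential diagram $X_1\xrightarrow{f_1}X_2\xrightarrow{f_2}\cdots$ of epimorphisms has a colimit, and, for each natural transformation $m_n\colon X_n\to Y_n$ between two such diagrams $(X_n,f_n)$, $(Y_n,g_n)$ whose components are all dagger monic, the induced morphism $m_\infty\colon\operatorname{colim}X_n\to\operatorname{colim}Y_n$ is also dagger monic. (A10) Every object $X$ is dagger finite: each $f\colon X\to X$ with $f^\dagger f=1$ satisfies $ff^\dagger=1$. The localisation $U\colon\mathbf{D}\to\mathbf{C}$. For $a\colon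 I\to I$ and $f\colon X\to Y$ in $\mathbf{D}$, let $a\cdot f=(X\cong I\otimes X\xrightarrow{a\otimes f}I\otimes Y\cong Y)$. The category $\mathbf{C}$ has the same objects as $\mathbf{D}$; its morphisms $X\to Y$ are equivalence classes $f/a$ of pairs $(f,a)$ with $f\colon X\to Y$ and $0\ne a\colon I\to I$ in $\mathbf{D}$, where $(f,a)\simeq(g,b)$ iff $b\cdot f=a\cdot g$; composition is $(g/b)(f/a)=(gf)/(ba)$; the dagger is $(f/a)^\dagger=f^\dagger/a^\dagger$; and $\frac fa\otimes\frac gb=\frac{f\otimes g}{ab}$, $\frac fa\oplus\frac gb=\frac{b\cdot f\oplus a\cdot g}{ab}$. $U$ is the identity on objects and $f\mapsto f/1$ on morphisms. In $\mathbf{C}$, $O$ is a zero object and $X\oplus Y$ with $i_1,i_2,p_1,p_2$ is a dagger biproduct, so hom-sets carry an addition, and $\mathcal{C}=\mathbf{C}(I,I)$ is an involutive field of characteristic zero (multiplication is composition, involution is $\dagger$). Positive scalars. $\mathcal{R}_+$ is the set of all $x^\dagger x\in\mathcal{C}$ with $x\colon I\to X$ a morphism of $\mathbf{C}$, $X$ any object. $\mathbb{R}$ and $\mathbb{C}$ are involutive fields with trivial involution and complex conjugation, respectively; the isomorphism is one of involutive fields. *)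

(* Defs.v *)
From HB Require Import structures.
From mathcomp Require Import all_boot all_order all_algebra generic_quotient.
From mathcomp Require Import boolp classical_sets functions reals.
From mathcomp Require Import complex.

Set Implicit Arguments.
Unset Strict Implicit.
Unset Printing Implicit Defensive.

Declare Scope dagcat_scope.
Delimit Scope dagcat_scope with dagcat.
Local Open Scope dagcat_scope.

(* Locally small: each hom X Y is a type, compared by Leibniz equality; the
   objects may live in a larger universe. *)
Record daggerCategory := DaggerCategory {
  ob :> Type;
  hom : ob -> ob -> Type;
  idm : forall X, hom X X;
  comp : forall X Y Z, hom Y Z -> hom X Y -> hom X Z;
  dag : forall X Y, hom X Y -> hom Y X;
  compA : forall W X Y Z (h : hom Y Z) (g : hom X Y) (f : hom W X),
    comp h (comp g f) = comp (comp h g) f;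
  comp1m : forall X Y (f : hom X Y), comp (idm Y) f = f;
  compm1 : forall X Y (f : hom X Y), comp f (idm X) = f;
  dag1 : forall X, dag (idm X) = idm X;
  dagM : forall X Y Z (g : hom Y Z) (f : hom X Y),
    dag (comp g f) = comp (dag f) (dag g);
  dagK : forall X Y (f : hom X Y), dag (dag f) = f }.

Arguments hom {_} _ _.
Arguments idm {_} _.
Arguments comp {_ _ _ _} _ _.
Arguments dag {_ _ _} _.

Notation "X ~> Y" := (hom X Y) (at level 70, no associativity) : dagcat_scope.
Notation "g ∘ f" := (comp g f) (at level 40, left associativity) : dagcat_scope.
Notation "f ^†" := (dag f) (at level 2, format "f ^†") : dagcat_scope.

Section Morphisms.
Variable C : daggerCategory.
Implicit Types X Y Z : C.

Definition daggerMono X Y (f : X ~> Y) : Prop := f^† ∘ f = idm X.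
Definition daggerIso X Y (f : X ~> Y) : Prop :=
  f^† ∘ f = idm X /\ f ∘ f^† = idm Y.
Definition isIso X Y (f : X ~> Y) : Prop :=
  exists g : Y ~> X, g ∘ f = idm X /\ f ∘ g = idm Y.
Definition epi X Y (f : X ~> Y) : Prop :=
  forall Z (g h : Y ~> Z), g ∘ f = h ∘ f -> g = h.
Definition isEqualiser E X Y (f g : X ~> Y) (e : E ~> X) : Prop :=
  f ∘ e = g ∘ e /\
  forall Z (h : Z ~> X), f ∘ h = g ∘ h -> exists! k : Z ~> E, e ∘ k = h.
Definition terminal X : Prop := forall Y, exists! f : Y ~> X, True.

(* Equality of the subobjects represented by m and n. *)
Definition eqSubobject A B X (m : A ~> X) (n : B ~> X) : Prop :=
  exists u : A ~> B, isIso u /\ n ∘ u = m.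

Definition isCocone (X : nat -> C) (f : forall n, X n ~> X n.+1)
    (L : C) (c : forall n, X n ~> L) : Prop :=
  forall n, c n.+1 ∘ f n = c n.
Definition isColimit (X : nat -> C) (f : forall n, X n ~> X n.+1)
    (L : C) (c : forall n, X n ~> L) : Prop :=
  isCocone f c /\
  forall (Z : C) (t : forall n, X n ~> Z), isCocone f t ->
    exists! h : L ~> Z, forall n, h ∘ c n = t n.

End Morphisms.

Record daggerSMC (C : daggerCategory) := DaggerSMC {
  tob : C -> C -> C;
  thom : forall X X' Y Y' : C,
    X ~> X' -> Y ~> Y' -> tob X Y ~> tob X' Y';
  tunit : C;
  assoc : forall X Y Z, tob (tob X Y) Z ~> tob X (tob Y Z);
  lunit : forall X, tob tunit X ~> X;
  runit : forall X, tob X tunit ~> X;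
  symm : forall X Y, tob X Y ~> tob Y X;
  thom1 : forall X Y, thom (idm X) (idm Y) = idm (tob X Y);
  thomM : forall X X' X'' Y Y' Y'' (g : X' ~> X'') (f : X ~> X')
      (k : Y' ~> Y'') (h : Y ~> Y'),
    thom (g ∘ f) (k ∘ h) = thom g k ∘ thom f h;
  thom_dag : forall X X' Y Y' (f : X ~> X') (g : Y ~> Y'),
    thom f^† g^† = (thom f g)^†;
  assoc_nat : forall X X' Y Y' Z Z' (f : X ~> X') (g : Y ~> Y') (h : Z ~> Z'),
    assoc X' Y' Z' ∘ thom (thom f g) h = thom f (thom g h) ∘ assoc X Y Z;
  lunit_nat : forall X Y (f : X ~> Y),
    lunit Y ∘ thom (idm tunit) f = f ∘ lunit X;
  runit_nat : forall X Y (f : X ~> Y),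
    runit Y ∘ thom f (idm tunit) = f ∘ runit X;
  symm_nat : forall X X' Y Y' (f : X ~> X') (g : Y ~> Y'),
    symm X' Y' ∘ thom f g = thom g f ∘ symm X Y;
  assoc_iso : forall X Y Z, daggerIso (assoc X Y Z);
  lunit_iso : forall X, daggerIso (lunit X);
  runit_iso : forall X, daggerIso (runit X);
  symm_iso : forall X Y, daggerIso (symm X Y);
  pentagon : forall W X Y Z,
    assoc W X (tob Y Z) ∘ assoc (tob W X) Y Z =
    thom (idm W) (assoc X Y Z) ∘ assoc W (tob X Y) Z
      ∘ thom (assoc W X Y) (idm Z);
  triangle : forall X Y,
    thom (idm X) (lunit Y) ∘ assoc X tunit Y = thom (runit X) (idm Y);
  symmK : forall X Y, symm Y X ∘ symm X Y = idm (tob X Y);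
  hexagon : forall X Y Z,
    assoc Y Z X ∘ symm X (tob Y Z) ∘ assoc X Y Z =
    thom (idm Y) (symm X Z) ∘ assoc Y X Z ∘ thom (symm X Y) (idm Z) }.

Arguments tob {_} _ _ _.
Arguments thom {_} _ {_ _ _ _} _ _.
Arguments tunit {_} _.
Arguments assoc {_} _ _ _ _.
Arguments lunit {_} _ _.
Arguments runit {_} _ _.
Arguments symm {_} _ _ _.

Definition interchange (C : daggerCategory) (M : daggerSMC C) (W X Y Z : C) :
    tob M (tob M W X) (tob M Y Z) ~> tob M (tob M W Y) (tob M X Z) :=
  (assoc M W Y (tob M X Z))^†
  ∘ thom M (idm W)
      (assoc M Y X Z ∘ thom M (symm M X Y) (idm Z) ∘ (assoc M X Y Z)^†)
  ∘ assoc M W X (tob M Y Z).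

Record daggerRig := DaggerRig {
  rcat :> daggerCategory;
  rmul : daggerSMC rcat;
  radd : daggerSMC rcat;
  rI := tunit rmul;
  rO := tunit radd;
  tens := tob rmul;
  plus := tob radd;
  tensm := fun X X' Y Y' => @thom _ rmul X X' Y Y';
  plusm := fun X X' Y Y' => @thom _ radd X X' Y Y';
  distl : forall A X Y, tens A (plus X Y) ~> plus (tens A X) (tens A Y);
  distr : forall X Y A, tens (plus X Y) A ~> plus (tens X A) (tens Y A);
  annr : forall X, tens X rO ~> rO;
  annl : forall X, tens rO X ~> rO;
  distl_nat : forall A A' X X' Y Y' (a : A ~> A') (f : X ~> X') (g : Y ~> Y'),
    distl A' X' Y' ∘ tensm a (plusm f g) =
    plusm (tensm a f) (tensm a g) ∘ distl A X Y;
  distr_nat : forall A A' X X' Y Y' (a : A ~> A') (f : X ~> X') (g : Y ~> Y'),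
    distr X' Y' A' ∘ tensm (plusm f g) a =
    plusm (tensm f a) (tensm g a) ∘ distr X Y A;
  annr_nat : forall X Y (f : X ~> Y), annr Y ∘ tensm f (idm rO) = annr X;
  annl_nat : forall X Y (f : X ~> Y), annl Y ∘ tensm (idm rO) f = annl X;
  distl_iso : forall A X Y, daggerIso (distl A X Y);
  distr_iso : forall X Y A, daggerIso (distr X Y A);
  annr_iso : forall X, daggerIso (annr X);
  annl_iso : forall X, daggerIso (annl X);
  rig_distl_symm : forall A B C,
    symm radd (tens A B) (tens A C) ∘ distl A B C =
    distl A C B ∘ tensm (idm A) (symm radd B C);
  rig_distr_distl : forall A B C,
    plusm (symm rmul A C) (symm rmul B C) ∘ distr A B C =
    distl C A B ∘ symm rmul (plus A B) C;
  rig_distl_assoc : forall A B C D,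
    assoc radd (tens A B) (tens A C) (tens A D)
      ∘ plusm (distl A B C) (idm (tens A D)) ∘ distl A (plus B C) D =
    plusm (idm (tens A B)) (distl A C D) ∘ distl A B (plus C D)
      ∘ tensm (idm A) (assoc radd B C D);
  rig_distl_distl : forall A B C D,
    distl A (tens B C) (tens B D) ∘ tensm (idm A) (distl B C D)
      ∘ assoc rmul A B (plus C D) =
    plusm (assoc rmul A B C) (assoc rmul A B D) ∘ distl (tens A B) C D;
  rig_interchange : forall A B C D,
    interchange radd (tens A C) (tens B C) (tens A D) (tens B D)
      ∘ plusm (distr A B C) (distr A B D) ∘ distl (plus A B) C D =
    plusm (distl A C D) (distl B C D) ∘ distr A B (plus C D);
  rig_annl_annr : annl rO = annr rO;
  rig_annl_plus : forall A B,
    annl (plus A B) =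
    lunit radd rO ∘ plusm (annl A) (annl B) ∘ distl rO A B;
  rig_annl_unit : annl rI = runit rmul rO;
  rig_annr_symm : forall A, annr A ∘ symm rmul rO A = annl A;
  rig_annl_assoc : forall A B,
    annl (tens A B) ∘ assoc rmul rO A B =
    annl B ∘ tensm (annl A) (idm B);
  rig_distl_zero : forall A B,
    lunit radd (tens A B) ∘ plusm (annr A) (idm (tens A B)) ∘ distl A rO B =
    tensm (idm A) (lunit radd B);
  rig_distl_unit : forall A B,
    plusm (lunit rmul A) (lunit rmul B) ∘ distl rI A B =
    lunit rmul (plus A B) }.

Arguments rI {_}.
Arguments rO {_}.
Arguments tens {_} _ _.
Arguments plus {_} _ _.
Arguments tensm {_ _ _ _ _} _ _.
Arguments plusm {_ _ _ _ _} _ _.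

Notation "X ⊗ Y" := (tens X Y) (at level 35, right associativity) : dagcat_scope.
Notation "X ⊕ Y" := (plus X Y) (at level 37, right associativity) : dagcat_scope.
Notation "f ⊗m g" := (tensm f g) (at level 35, right associativity) : dagcat_scope.
Notation "f ⊕m g" := (plusm f g) (at level 37, right associativity) : dagcat_scope.

Section Conditions.
Variable D : daggerRig.
Implicit Types X Y Z A B : D.

Section Zero.
Hypothesis O_terminal : terminal (rO : D).

Definition toO X : X ~> rO := projT1 (cid (O_terminal X)).
Definition zerom X Y : X ~> Y := (toO Y)^† ∘ toO X.
Definition inj1 X Y : X ~> X ⊕ Y :=
  (idm X ⊕m zerom rO Y) ∘ (runit (radd D) X)^†.
Definition inj2 X Y : Y ~> X ⊕ Y :=
  (zerom rO X ⊕m idm Y) ∘ (lunit (radd D) Y)^†.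
End Zero.

(* By ax8 with x the identity, every isomorphism is a dagger isomorphism, so
   quantifying over all colimits in ax9_mono is the same as choosing one. *)
Record conditions : Prop := Conditions {
  ax1 : terminal (rO : D);
  ax2 : forall X Y Z (f g : X ⊕ Y ~> Z),
    f ∘ inj1 ax1 X Y = g ∘ inj1 ax1 X Y ->
    f ∘ inj2 ax1 X Y = g ∘ inj2 ax1 X Y -> f = g;
  ax3 : exists d : rI ~> rI ⊕ rI,
    (inj1 ax1 rI rI)^† ∘ d <> zerom ax1 rI rI /\
    (inj2 ax1 rI rI)^† ∘ d <> zerom ax1 rI rI;
  ax4 : exists A B (m : A ~> rI) (n : B ~> rI),
    [/\ daggerMono m, daggerMono n, ~ eqSubobject m n
      & forall E (k : E ~> rI), daggerMono k ->
          eqSubobject k m \/ eqSubobject k n];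
  ax5 : forall X Y Z (f g : X ⊗ Y ~> Z),
    (forall (x : rI ~> X) (y : rI ~> Y), f ∘ (x ⊗m y) = g ∘ (x ⊗m y)) -> f = g;
  ax6 : forall X Y (f g : X ~> Y), exists E (e : E ~> X),
    isEqualiser f g e /\ daggerMono e;
  ax7 : forall A X (m : A ~> X), daggerMono m ->
    exists Y (f : X ~> Y), isEqualiser f (zerom ax1 X Y) m;
  ax8 : forall A X Y (x : A ~> X) (y : A ~> Y), epi x -> epi y ->
    (x^† ∘ x = y^† ∘ y <-> exists f : X ~> Y, isIso f /\ y = f ∘ x);
  ax9_colim : forall (X : nat -> D) (f : forall n, X n ~> X n.+1),
    (forall n, epi (f n)) -> exists L (c : forall n, X n ~> L), isColimit f c;
  ax9_mono : forall (X Y : nat -> D) (f : forall n, X n ~> X n.+1)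
      (g : forall n, Y n ~> Y n.+1) (m : forall n, X n ~> Y n)
      L (c : forall n, X n ~> L) M (e : forall n, Y n ~> M) (h : L ~> M),
    (forall n, epi (f n)) -> (forall n, epi (g n)) ->
    (forall n, m n.+1 ∘ f n = g n ∘ m n) -> (forall n, daggerMono (m n)) ->
    isColimit f c -> isColimit g e -> (forall n, h ∘ c n = e n ∘ m n) ->
    daggerMono h;
  ax10 : forall X (f : X ~> X), f^† ∘ f = idm X -> f ∘ f^† = idm X }.

End Conditions.

Definition scale (D : daggerRig) (a : rI ~> (rI : D)) (X Y : D) (f : X ~> Y) :
    X ~> Y :=
  lunit (rmul D) Y ∘ (a ⊗m f) ∘ (lunit (rmul D) X)^†.
Notation "a · f" := (scale a f) (at level 38, right associativity) : dagcat_scope.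

Section Localisation.
Variables (D : daggerRig) (HD : conditions D).
Implicit Types (X Y Z : D) (a b c : rI ~> (rI : D)).

Local Notation "0" := (zerom (ax1 HD) _ _) : dagcat_scope.

Lemma toO_uniq X (f g : X ~> rO) : f = g.
Proof. by have [h [_ hu]] := ax1 HD X; rewrite -(hu f) // -(hu g). Qed.

Lemma ofO_uniq X (f g : rO ~> X) : f = g.
Proof. by rewrite -[f]dagK -[g]dagK (toO_uniq f^† g^†). Qed.

Lemma comp0m X Y Z (f : X ~> Y) : (0 : Y ~> Z) ∘ f = 0.
Proof.
by rewrite /zerom -compA
           (toO_uniq (toO (ax1 HD) Y ∘ f) (toO (ax1 HD) X)).
Qed.

Lemma compm0 X Y Z (f : Y ~> Z) : f ∘ (0 : X ~> Y) = 0.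
Proof.
by rewrite /zerom compA
           (ofO_uniq (f ∘ (toO (ax1 HD) Y)^†) (toO (ax1 HD) Z)^†).
Qed.

Lemma dag0 X Y : (0 : X ~> Y)^† = 0.
Proof. by rewrite /zerom dagM dagK. Qed.

Lemma thomr (M : daggerSMC D) X Y Z W (g : Y ~> Z) (f : X ~> Y) :
  thom M (idm W) (g ∘ f) = thom M (idm W) g ∘ thom M (idm W) f.
Proof. by rewrite -thomM comp1m. Qed.

Lemma tensmr X Y Z W (g : Y ~> Z) (f : X ~> Y) :
  idm W ⊗m (g ∘ f) = (idm W ⊗m g) ∘ (idm W ⊗m f).
Proof. exact: thomr. Qed.

Lemma isoK X Y Z (u : X ~> Y) (f : Z ~> X) : daggerIso u -> u^† ∘ (u ∘ f) = f.
Proof. by case=> uK _; rewrite compA uK comp1m. Qed.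

Lemma scaleM a b X Y Z (g : Y ~> Z) (f : X ~> Y) :
  (a ∘ b) · (g ∘ f) = (a · g) ∘ (b · f).
Proof.
rewrite /scale {1}/tensm thomM -!compA; congr (_ ∘ (_ ∘ _)).
by rewrite (isoK _ (lunit_iso (rmul D) Y)).
Qed.

Lemma scale1 X Y (f : X ~> Y) : idm rI · f = f.
Proof.
rewrite /scale lunit_nat -compA; have [_ ->] := lunit_iso (rmul D) X.
exact: compm1.
Qed.

Lemma scaler a X Y Z (g : Y ~> Z) (f : X ~> Y) : a · (g ∘ f) = g ∘ (a · f).
Proof. by rewrite -[a in LHS]comp1m scaleM scale1. Qed.

Lemma scalel a X Y Z (g : Y ~> Z) (f : X ~> Y) : a · (g ∘ f) = (a · g) ∘ f.
Proof. by rewrite -[a in LHS]compm1 scaleM scale1. Qed.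

Lemma scaleA a b X Y (f : X ~> Y) : a · (b · f) = (a ∘ b) · f.
Proof. by rewrite -[f in RHS]comp1m scaleM -scalel comp1m. Qed.

Lemma scaleC a b X Y (f : X ~> Y) : a · (b · f) = b · (a · f).
Proof.
by rewrite -[f in LHS]comp1m scalel scaler -scalel comp1m.
Qed.

Lemma scale_dag a X Y (f : X ~> Y) : (a · f)^† = a^† · f^†.
Proof. by rewrite /scale !dagM dagK {2}/tensm thom_dag compA. Qed.

Lemma scale_id_eq0 a : a · idm rI = 0 -> a = 0.
Proof.
move=> a0; have a10 : a ⊗m idm rI = 0.
  have := congr1 (fun f => (lunit (rmul D) rI)^† ∘ (f ∘ lunit (rmul D) rI)) a0.
  rewrite /= comp0m compm0 /scale -!compA (isoK _ (lunit_iso _ _)).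
  by have [-> _] := lunit_iso (rmul D) rI; rewrite compm1.
have := runit_nat (rmul D) a; rewrite -/(tensm _ _) a10 compm0 => e.
rewrite -[a]compm1; have [_ <-] := runit_iso (rmul D) rI.
by rewrite compA -e comp0m.
Qed.

Lemma daggerMono_scalar E (k : E ~> (rI : D)) : daggerMono k -> k = 0 \/ isIso k.
Proof.
have m0 : daggerMono (0 : (rO : D) ~> rI) by apply: toO_uniq.
have m1 : daggerMono (idm (rI : D)) by rewrite /daggerMono dag1 comp1m.
have sub0 A B (m : A ~> (rI : D)) (n : B ~> rI) : eqSubobject m n ->
    n = 0 -> m = 0.
  by move=> [u [_ <-]] ->; rewrite comp0m.
have sub1 A B (m : A ~> (rI : D)) (n : B ~> rI) : eqSubobject m n ->
    isIso n -> isIso m.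
  move=> [u [[v [vu uv]] <-]] [w [wn nw]]; exists (v ∘ w); split.
    by rewrite compA -(compA v) wn compm1.
  by rewrite compA -(compA n) uv compm1.
have symS A B (m : A ~> (rI : D)) (n : B ~> rI) :
    eqSubobject m n -> eqSubobject n m.
  move=> [u [[v [vu uv]] <-]]; exists v; split; first by exists u.
  by rewrite -compA uv compm1.
have traS A B E' (m : A ~> (rI : D)) (n : B ~> rI) (p : E' ~> rI) :
    eqSubobject m n -> eqSubobject n p -> eqSubobject m p.
  move=> [u [[u' [u'u uu']] <-]] [v [[v' [v'v vv']] <-]].
  exists (v ∘ u); split; last by rewrite compA.
  exists (u' ∘ v'); split.
    by rewrite compA -(compA u') v'v compm1.
  by rewrite compA -(compA v) uu' compm1.
have I1 : isIso (idm (rI : D)) by exists (idm rI); rewrite comp1m.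
have [A [B [m [n [dm dn mn mnP]]]]] := ax4 HD.
move=> /mnP kmn.
have [e0|e0] := mnP _ _ m0; have [e1|e1] := mnP _ _ m1; move: kmn.
- move=> _; left; rewrite -[k]comp1m.
  have [u [_ <-]] := traS _ _ _ _ _ _ e1 (symS _ _ _ _ e0).
  by rewrite !comp0m.
- move=> [km|kn].
    by left; apply: (sub0 _ _ _ _ km); apply: (sub0 _ _ _ _ (symS _ _ _ _ e0)).
  by right; apply: (sub1 _ _ _ _ kn); apply: (sub1 _ _ _ _ (symS _ _ _ _ e1)).
- move=> [km|kn].
    by right; apply: (sub1 _ _ _ _ km); apply: (sub1 _ _ _ _ (symS _ _ _ _ e1)).
  by left; apply: (sub0 _ _ _ _ kn); apply: (sub0 _ _ _ _ (symS _ _ _ _ e0)).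
- move=> _; left; rewrite -[k]comp1m.
  have [u [_ <-]] := traS _ _ _ _ _ _ e1 (symS _ _ _ _ e0).
  by rewrite !comp0m.
Qed.

Lemma scalar_epi a X (f g : rI ~> X) : a <> 0 -> f ∘ a = g ∘ a -> f = g.
Proof.
move=> a0 fg; have [E [e [[fe eP] de]]] := ax6 HD f g.
have [k [ka _]] := eP _ _ fg.
case: (daggerMono_scalar de) => [e0|[e' [_ ee']]].
  by case: a0; rewrite -ka e0 comp0m.
by rewrite -[f]compm1 -[g]compm1 -ee' !compA fe.
Qed.

Lemma dag_neq0 a : a <> 0 -> a^† <> 0.
Proof. by move=> a0 e; apply: a0; rewrite -[a]dagK e dag0. Qed.

Lemma scalarM_neq0 a b : a <> 0 -> b <> 0 -> a ∘ b <> 0.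
Proof.
by move=> a0 b0 e; apply/a0/(@scalar_epi b) => //; rewrite e comp0m.
Qed.

Lemma id_neq0 : idm (rI : D) <> 0.
Proof.
have [d [dn0 _]] := ax3 HD; move=> e; apply: dn0.
by rewrite -[LHS]comp1m e comp0m.
Qed.

Lemma scaleI a X Y (f g : X ~> Y) : a <> 0 -> a · f = a · g -> f = g.
Proof.
move=> a0 fg.
have fgx (x : rI ~> X) : f ∘ x = g ∘ x.
  apply: (@scalar_epi (a · idm rI)); first by move=> /scale_id_eq0.
  by rewrite -!scaler !compm1 !scalel fg.
have fgr : f ∘ runit (rmul D) X = g ∘ runit (rmul D) X.
  apply: (ax5 HD) => x y.
  have -> : x ⊗m y = (x ⊗m idm rI) ∘ (idm rI ⊗m y).
    by rewrite /tensm -thomM compm1 comp1m.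
  by rewrite !compA -!(compA _ (runit _ _)) runit_nat !compA fgx.
have [_ rK] := runit_iso (rmul D) X.
by rewrite -[f]compm1 -[g]compm1 -rK !compA fgr.
Qed.

Definition nzScalar := {a : rI ~> (rI : D) | a <> 0}.
Definition NzScalar a (a0 : a <> 0) : nzScalar := exist (fun a => a <> 0) a a0.
Definition nzId : nzScalar := NzScalar id_neq0.
Definition nzMul (a b : nzScalar) : nzScalar :=
  NzScalar (scalarM_neq0 (proj2_sig a) (proj2_sig b)).
Definition nzDag (a : nzScalar) : nzScalar :=
  NzScalar (dag_neq0 (proj2_sig a)).

Section Fractions.
Variables X Y : D.

(* The pairs (f, a) with a nonzero; {classic _} supplies the choice structure
   that {eq_quot _} requires. *)
Definition preFrac := {classic ((X ~> Y) * nzScalar)%type}.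
Definition equivFrac : rel preFrac := fun p q =>
  `[< sval q.2 · p.1 = sval p.2 · q.1 >].

Lemma equivFrac_refl : reflexive equivFrac.
Proof. by move=> p; apply/asboolP. Qed.

Lemma equivFrac_sym : symmetric equivFrac.
Proof. by move=> p q; apply/asboolP/asboolP => ->. Qed.

Lemma equivFrac_trans : transitive equivFrac.
Proof.
move=> [g b] [f a] [h c] /asboolP /= fg /asboolP /= gh; apply/asboolP => /=.
apply: (scaleI (proj2_sig b)).
by rewrite scaleC fg scaleC gh scaleC.
Qed.

Canonical equivFrac_equiv :=
  EquivRel equivFrac equivFrac_refl equivFrac_sym equivFrac_trans.

Definition lhom := {eq_quot equivFrac}%qT.

Definition frac (f : X ~> Y) (a : nzScalar) : lhom :=
  (\pi_lhom ((f, a) : preFrac))%qT.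
Definition fnum (F : lhom) : X ~> Y := (repr F : preFrac).1.
Definition fden (F : lhom) : nzScalar := (repr F : preFrac).2.

Lemma num_den F : frac (fnum F) (fden F) = F.
Proof. by rewrite /frac /fnum /fden -surjective_pairing reprK. Qed.

Lemma fracE f (a : nzScalar) g (b : nzScalar) :
  frac f a = frac g b <-> sval b · f = sval a · g.
Proof.
split=> [/eqmodP/asboolP //|fg].
by apply/eqmodP/asboolP.
Qed.

End Fractions.

Definition lid X : lhom X X := frac (idm X) nzId.
Definition lcomp X Y Z (G : lhom Y Z) (F : lhom X Y) : lhom X Z :=
  frac (fnum G ∘ fnum F) (nzMul (fden G) (fden F)).
Definition ldag X Y (F : lhom X Y) : lhom Y X :=
  frac (fnum F)^† (nzDag (fden F)).

Lemma lcompE X Y Z (g : Y ~> Z) (b : nzScalar)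
    (f : X ~> Y) (a : nzScalar) :
  lcomp (frac g b) (frac f a) = frac (g ∘ f) (nzMul b a).
Proof.
apply/fracE => /=; rewrite !scaleM.
by congr (_ ∘ _); apply/fracE; rewrite num_den.
Qed.

Lemma ldagE X Y (f : X ~> Y) (a : nzScalar) : ldag (frac f a) = frac f^† (nzDag a).
Proof.
apply/fracE => /=; rewrite -!scale_dag; congr (_^†).
by apply/fracE; rewrite num_den.
Qed.

Lemma lcompA W X Y Z (h : lhom Y Z) (g : lhom X Y) (f : lhom W X) :
  lcomp h (lcomp g f) = lcomp (lcomp h g) f.
Proof.
by rewrite -(num_den h) -(num_den g) -(num_den f) !lcompE; apply/fracE;
   rewrite /= !compA.
Qed.

Lemma lcomp1m X Y (f : lhom X Y) : lcomp (lid Y) f = f.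
Proof.
by rewrite -(num_den f) lcompE; apply/fracE; rewrite /= !comp1m.
Qed.

Lemma lcompm1 X Y (f : lhom X Y) : lcomp f (lid X) = f.
Proof.
by rewrite -(num_den f) lcompE; apply/fracE; rewrite /= !compm1.
Qed.

Lemma ldag1 X : ldag (lid X) = lid X.
Proof. by rewrite ldagE; apply/fracE; rewrite /= !dag1. Qed.

Lemma ldagM X Y Z (g : lhom Y Z) (f : lhom X Y) :
  ldag (lcomp g f) = lcomp (ldag f) (ldag g).
Proof.
rewrite -(num_den g) -(num_den f) !(lcompE, ldagE); apply/fracE.
by rewrite /= !dagM.
Qed.

Lemma ldagK X Y (f : lhom X Y) : ldag (ldag f) = f.
Proof. by rewrite -(num_den f) !ldagE; apply/fracE; rewrite /= !dagK. Qed.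

Definition localisation : daggerCategory :=
  DaggerCategory lcompA lcomp1m lcompm1 ldag1 ldagM ldagK.

Definition Uob (X : D) : localisation := X.
Definition locF X Y (f : X ~> Y) : Uob X ~> Uob Y := frac f nzId.

Definition linj1 X Y : Uob X ~> Uob (X ⊕ Y) := locF (inj1 (ax1 HD) X Y).
Definition linj2 X Y : Uob Y ~> Uob (X ⊕ Y) := locF (inj2 (ax1 HD) X Y).

Local Notation P1 X Y := (inj1 (ax1 HD) X Y)^†.
Local Notation P2 X Y := (inj2 (ax1 HD) X Y)^†.

Lemma daggerIsoM X Y Z (g : Y ~> Z) (f : X ~> Y) :
  daggerIso g -> daggerIso f -> daggerIso (g ∘ f).
Proof.
move=> [gK Kg] [fK Kf]; split; rewrite dagM compA.
  by rewrite -(compA f^†) gK compm1.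
by rewrite -(compA g) Kf compm1.
Qed.

Lemma daggerIsoV X Y (f : X ~> Y) : daggerIso f -> daggerIso f^†.
Proof. by move=> [fK Kf]; split; rewrite dagK. Qed.

Lemma daggerIsor (M : daggerSMC D) A X Y (f : X ~> Y) :
  daggerIso f -> daggerIso (thom M (idm A) f).
Proof.
by move=> [fK Kf]; split; rewrite -thom_dag -thomM dag1 comp1m ?fK ?Kf thom1.
Qed.

Lemma P1E X Y : P1 X Y = runit (radd D) X ∘ (idm X ⊕m 0).
Proof. by rewrite /inj1 dagM dagK /plusm -thom_dag dag1 dag0. Qed.

Lemma P2E X Y : P2 X Y = lunit (radd D) Y ∘ (0 ⊕m idm Y).
Proof. by rewrite /inj2 dagM dagK /plusm -thom_dag dag1 dag0. Qed.

Lemma P1_nat X X' Y Y' (f : X ~> X') (g : Y ~> Y') :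
  P1 X' Y' ∘ (f ⊕m g) = f ∘ P1 X Y.
Proof.
rewrite !P1E compA -runit_nat -!compA /plusm -!thomM !comp1m compm1.
by rewrite comp0m.
Qed.

Lemma P2_nat X X' Y Y' (f : X ~> X') (g : Y ~> Y') :
  P2 X' Y' ∘ (f ⊕m g) = g ∘ P2 X Y.
Proof.
rewrite !P2E compA -lunit_nat -!compA /plusm -!thomM !comp1m compm1.
by rewrite comp0m.
Qed.

Lemma P2_distl A X Y :
  P2 (A ⊗ X) (A ⊗ Y) ∘ distl A X Y = idm A ⊗m P2 X Y.
Proof.
rewrite !P2E tensmr -rig_distl_zero -!compA distl_nat.
rewrite (compA (annr A ⊕m _)) /plusm -thomM.
rewrite [idm A ⊗m idm Y](thom1 (rmul D)) comp1m.
by rewrite (toO_uniq (annr A ∘ _) 0).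
Qed.

Definition swapU X : X ~> X :=
  lunit (radd D) X ∘ symm (radd D) X rO ∘ (runit (radd D) X)^†.

Lemma swapU_iso X : daggerIso (swapU X).
Proof.
apply: daggerIsoM; last exact/daggerIsoV/runit_iso.
by apply: daggerIsoM; [exact: lunit_iso|exact: symm_iso].
Qed.

Lemma P2_symm X Y : P2 Y X ∘ symm (radd D) X Y = swapU X ∘ P1 X Y.
Proof.
rewrite P1E P2E /swapU -!compA (isoK _ (runit_iso _ _)).
by rewrite /plusm symm_nat.
Qed.

Lemma P1_distl A X Y : exists v, daggerIso v /\
  P1 (A ⊗ X) (A ⊗ Y) ∘ distl A X Y = v ∘ (idm A ⊗m P1 X Y).
Proof.
exists ((swapU (A ⊗ X))^† ∘ (idm A ⊗m swapU X)); split.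
  apply: daggerIsoM; first exact/daggerIsoV/swapU_iso.
  exact/daggerIsor/swapU_iso.
rewrite -[LHS](isoK _ (swapU_iso _)) (compA (swapU (A ⊗ X))) -P2_symm.
rewrite -[RHS]compA; congr (_ ∘ _).
by rewrite -compA rig_distl_symm compA P2_distl -!tensmr P2_symm.
Qed.

Lemma P2_distr X Y A :
  P2 (X ⊗ A) (Y ⊗ A) ∘ distr X Y A = P2 X Y ⊗m idm A.
Proof.
rewrite -[LHS](isoK _ (symm_iso (rmul D) Y A)).
rewrite -[RHS](isoK _ (symm_iso (rmul D) Y A)); congr (_ ∘ _).
by rewrite compA -(P2_nat (symm _ X A)) -compA rig_distr_distl compA P2_distl
           /tensm symm_nat.
Qed.

Lemma P1_distr X Y A : exists v, daggerIso v /\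
  P1 (X ⊗ A) (Y ⊗ A) ∘ distr X Y A = v ∘ (P1 X Y ⊗m idm A).
Proof.
have [v [v_iso vE]] := P1_distl A X Y.
exists ((symm (rmul D) X A)^† ∘ (v ∘ symm (rmul D) X A)); split.
  apply: daggerIsoM; first exact/daggerIsoV/symm_iso.
  by apply: daggerIsoM => //; exact: symm_iso.
rewrite -[LHS](isoK _ (symm_iso (rmul D) X A)) -[RHS]compA; congr (_ ∘ _).
rewrite compA -(P1_nat _ (symm _ Y A)) -compA rig_distr_distl compA vE.
by rewrite -!compA; congr (_ ∘ _); rewrite /tensm symm_nat.
Qed.

Lemma diag_ex : exists a b : nzScalar, forall Z, exists k : Z ~> Z ⊕ Z,
  P1 Z Z ∘ k = sval a · idm Z /\ P2 Z Z ∘ k = sval b · idm Z.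
Proof.
have [d [d1 d2]] := ax3 HD; exists (NzScalar d1), (NzScalar d2) => Z /=.
have [v [v_iso vE]] := P1_distr rI rI Z.
have lu := lunit_iso (rmul D) Z; set l := lunit _ Z in lu.
exists (((l ∘ v^†) ⊕m l) ∘ distr rI rI Z ∘ (d ⊗m idm Z) ∘ l^†).
split; rewrite !compA ?P1_nat ?P2_nat /scale -/l; congr (_ ∘ _).
  rewrite -!compA (compA (P1 _ _)) vE -!compA (isoK _ v_iso).
  by rewrite /tensm -thomM comp1m.
by rewrite -!compA (compA (P2 _ _)) P2_distr /tensm -thomM comp1m.
Qed.

(* The universal property that makes locF i1, locF i2 a dagger biproduct; the
   one for coproducts is its image under the dagger. *)
Lemma loc_product Z X Y (F : Uob Z ~> Uob X) (G : Uob Z ~> Uob Y) :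
  exists! K : Uob Z ~> Uob (X ⊕ Y),
    (linj1 X Y)^† ∘ K = F /\ (linj2 X Y)^† ∘ K = G.
Proof.
suff [K [K1 K2]] : exists K : Uob Z ~> Uob (X ⊕ Y),
    (linj1 X Y)^† ∘ K = F /\ (linj2 X Y)^† ∘ K = G.
  exists K; split=> // K' [K'1 K'2]; move: K1 K2.
  rewrite -K'1 -K'2 -(num_den K) -(num_den K') /= !ldagE !lcompE.
  move=> /fracE /= e1 /fracE /= e2; apply/fracE.
  have e1' : P1 X Y ∘ (sval (fden K') · fnum K)
           = P1 X Y ∘ (sval (fden K) · fnum K').
    by rewrite -!scaler; move: e1; rewrite !dag1 !comp1m.
  have e2' : P2 X Y ∘ (sval (fden K') · fnum K)
           = P2 X Y ∘ (sval (fden K) · fnum K').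
    by rewrite -!scaler; move: e2; rewrite !dag1 !comp1m.
  rewrite -[LHS]dagK -[RHS]dagK; congr (_^†).
  apply: (@ax2 _ HD).
    by rewrite -[inj1 _ _ _]dagK -!dagM e1'.
  by rewrite -[inj2 _ _ _]dagK -!dagM e2'.
have [a0 [b0 /(_ Z) [k [k1 k2]]]] := diag_ex.
change (lhom Z X) in F; change (lhom Z Y) in G.
pose f := fnum F; pose a := fden F; pose g := fnum G; pose b := fden G.
exists (frac (((sval b · sval b0 · f) ⊕m (sval a · sval a0 · g)) ∘ k)
             (nzMul (nzMul a b) (nzMul a0 b0))).
rewrite -(num_den F) -(num_den G) /= !ldagE !lcompE; split; apply/fracE => /=.
  rewrite dag1 comp1m (compA (P1 X Y)) P1_nat -(compA _ (P1 Z Z)) k1.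
  rewrite -/f -/a -!scalel -scaler compm1 -!scaleA.
  by rewrite (scaleC (sval b0)).
rewrite dag1 comp1m (compA (P2 X Y)) P2_nat -(compA _ (P2 Z Z)) k2.
rewrite -/g -/b -!scalel -scaler compm1 -!scaleA.
exact: scaleC.
Qed.

Definition lpair Z X Y (F : Uob Z ~> Uob X) (G : Uob Z ~> Uob Y) :
    Uob Z ~> Uob (X ⊕ Y) :=
  projT1 (cid (loc_product F G)).

Definition lcopair Z X Y (F : Uob X ~> Uob Z) (G : Uob Y ~> Uob Z) :
    Uob (X ⊕ Y) ~> Uob Z :=
  (lpair F^† G^†)^†.

(* The addition of a category with biproducts. *)
Definition ladd X Y (F G : Uob X ~> Uob Y) : Uob X ~> Uob Y :=
  lcopair (idm (Uob Y)) (idm (Uob Y)) ∘ lpair F G.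

Definition scalars := Uob rI ~> Uob rI.

Definition positiveScalars : set scalars :=
  [set s | exists (X : localisation) (x : Uob rI ~> X), s = x^† ∘ x].

(* The target K is a field with involution bar; preservation of 0, opposites
   and inverses is automatic for such a bijection. *)
Definition involutiveFieldIso (K : fieldType) (bar : K -> K)
    (phi : scalars -> K) : Prop :=
  [/\ bijective phi, phi (idm (Uob rI)) = 1%R,
      forall s t, phi (ladd s t) = (phi s + phi t)%R,
      forall s t, phi (s ∘ t) = (phi s * phi t)%R
    & forall s, phi s^† = bar (phi s)].

End Localisation.

Arguments positiveScalars {D} HD.

(* Main.v *)
From HB Require Import structures.
Require Import Defs.
From mathcomp Require Import all_boot all_order all_algebra.
From mathcomp Require Import boolp classical_sets functions reals.
From mathcomp Require Import complex zify ring lra.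

Set Implicit Arguments.
Unset Strict Implicit.
Unset Printing Implicit Defensive.

Import Order.TTheory GRing.Theory Num.Theory.

Local Open Scope classical_set_scope.
Local Open Scope complex_scope.
Local Open Scope ring_scope.

(** The proof makes the scalars into an ordered field in which decreasing
sequences of positive elements have infima, and concludes as for the classical
characterisation of the real numbers.

The field. Addition comes from the biproducts of the localisation. Opposites
exist because the codiagonal [I ⊕ I -> I] has a nonzero kernel: otherwise the
diagonal would be epic, by [ax6] and [ax7], and the two projections of [I ⊕ I]
would agree ([opposite_one]). The positive scalars are closed under sums,
products and inverses, and contain [s] and [- s] only for [s = 0].

Contractions. Isometries of the localisation lift to [D]: a unitary [f/a] does
because [f] and [a · idm] have equal [x^† ∘ x], so that [ax8] applies, and an
isometry is a unitary followed by a dagger monomorphism, by splitting the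
projection onto its range ([isometry_lift]). Let a contractive scalar be the
squared norm of a morphism [I -> X] of [D]. If [s] and [1 - s] are squared norms
of [x] and [z], then [(x, z)] is an isometry, whence [s] is contractive
([Con_le1]). Write [s ⊑ t] when [s = e * t] with [e] contractive; for norms of
points this means that one point factors through the other in [D]
([factor_of_below], [below_of_factor]).

Infima. A decreasing sequence for [⊑] is thus a sequential diagram of
epimorphisms under [I], and its colimit computes an infimum ([colimit_isInf]).
As colimits preserve dagger monomorphisms, by [ax9_mono], adding a positive
scalar preserves these infima ([isInfD]). For contractive [e] other than 0 and 1, put
[s n = 1 + ... + e ^ n]. Then [1 / s n + e = e ^ n.+1 / s n + 1], and taking
infima of both sides exhibits [1 - e] as an infimum of positive scalars, hence
as positive ([Con_ge0]). So [⊑] is the order of the positive cone, which is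
therefore complete for decreasing sequences ([Pos_complete]).

Order. In a field with such a cone, scalars between 0 and 1 have positive
square roots, by iteration. Comparing [s] with the square root of [s ^ 2] makes
bounded self-adjoint elements comparable with zero, and then the order is total
and Archimedean ([P_total], [P_archimedean]). The map sending a self-adjoint
element to the real number with the same cut is an isomorphism. If the
involution is not trivial, an element [w] with [bar w = - w] can be rescaled to
an imaginary unit, which extends the isomorphism to the complex numbers. *)

Section Localised.
Variables (D : daggerRig) (HD : conditions D).
Local Open Scope dagcat_scope.

Local Notation compA := Defs.compA.
Local Notation zero X Y := (zerom (ax1 HD) X Y).
Local Notation "X ⇝ Y" := (Uob HD X ~> Uob HD Y) (at level 70, no associativity).
Local Notation U f := (locF HD f).
Local Notation i1 X Y := (inj1 (ax1 HD) X Y).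
Local Notation i2 X Y := (inj2 (ax1 HD) X Y).
Local Notation Id X := (idm (Uob HD X)).

(** * The localisation functor *)

Lemma locFM (X Y Z : D) (g : Y ~> Z) (f : X ~> Y) : U (g ∘ f) = U g ∘ U f.
Proof.
by rewrite /locF [RHS]lcompE; apply/fracE; rewrite /= comp1m.
Qed.

Lemma locF_dag (X Y : D) (f : X ~> Y) : U f^† = (U f)^†.
Proof. by rewrite /locF [RHS]ldagE; apply/fracE; rewrite /= dag1. Qed.

Lemma locF_inj (X Y : D) (f g : X ~> Y) : U f = U g -> f = g.
Proof. by move=> /fracE /=; rewrite !scale1. Qed.

(** Clearing denominators. Together with the cancellation law [locF_scaleI], this
allows arguments in the localisation without explicit fractions. *)
Lemma locF_den (X Y : D) (F : X ⇝ Y) :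
  U (sval (fden F) · idm Y) ∘ F = U (fnum F).
Proof.
rewrite -{2}[F]num_den /locF [LHS]lcompE; apply/fracE.
by rewrite /= scale1 comp1m -scalel comp1m.
Qed.

Lemma locF_scaleI a (X Y : D) (F G : X ⇝ Y) : a <> zero rI rI ->
  U (a · idm Y) ∘ F = U (a · idm Y) ∘ G -> F = G.
Proof.
move=> a0; rewrite -[F]num_den -[G]num_den /locF [X in X = _]lcompE [X in _ = X]lcompE.
move=> /fracE /= e.
apply/fracE; apply: (scaleI a0).
by move: e; rewrite !comp1m -!scalel !comp1m => e; rewrite scaleC e scaleC.
Qed.

Lemma locF_scaleC a (X Y : D) (F : X ⇝ Y) :
  U (a · idm Y) ∘ F = F ∘ U (a · idm X).
Proof.
rewrite -[F]num_den /locF [LHS]lcompE [RHS]lcompE; apply/fracE.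
rewrite /= comp1m compm1; congr (_ · _).
by rewrite -scalel comp1m -scaler compm1.
Qed.

Lemma scale0 a (X Y : D) : a · zero X Y = zero X Y.
Proof. by rewrite -{1}(comp0m HD Y (idm X)) scaler comp0m. Qed.

Definition zeroL X Y : X ⇝ Y := U (zero X Y).

Lemma comp0L X Y Z (F : X ⇝ Y) : zeroL Y Z ∘ F = zeroL X Z.
Proof.
rewrite -[F]num_den [LHS]lcompE; apply/fracE.
by rewrite /= comp0m !scale0.
Qed.

Lemma compL0 X Y Z (F : Y ⇝ Z) : F ∘ zeroL X Y = zeroL X Z.
Proof.
rewrite -[F]num_den [LHS]lcompE; apply/fracE.
by rewrite /= compm0 !scale0.
Qed.

Lemma dag0L X Y : (zeroL X Y)^† = zeroL Y X.
Proof. by rewrite /zeroL -locF_dag dag0. Qed.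

(** * Biproducts and the addition of morphisms *)

Local Notation j1 X Y := (linj1 HD X Y).
Local Notation j2 X Y := (linj2 HD X Y).

Lemma P1_i1 (X Y : D) : (i1 X Y)^† ∘ i1 X Y = idm X.
Proof.
rewrite P1E /inj1 compA -(compA (runit _ _)) /plusm -thomM comp1m comp0m.
rewrite (toO_uniq HD (zero rO rO) (idm rO)) thom1 compm1.
by have [_ ->] := runit_iso (radd D) X.
Qed.

Lemma P2_i2 (X Y : D) : (i2 X Y)^† ∘ i2 X Y = idm Y.
Proof.
rewrite P2E /inj2 compA -(compA (lunit _ _)) /plusm -thomM comp1m comp0m.
rewrite (toO_uniq HD (zero rO rO) (idm rO)) thom1 compm1.
by have [_ ->] := lunit_iso (radd D) Y.
Qed.

Lemma i1_nat (X X' Y Y' : D) (f : X ~> X') (g : Y ~> Y') :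
  (f ⊕m g) ∘ i1 X Y = i1 X' Y' ∘ f.
Proof.
rewrite -[LHS]dagK dagM /plusm -thom_dag -[thom _ _ _]/(f^† ⊕m g^†) P1_nat.
by rewrite dagM !dagK.
Qed.

Lemma i2_nat (X X' Y Y' : D) (f : X ~> X') (g : Y ~> Y') :
  (f ⊕m g) ∘ i2 X Y = i2 X' Y' ∘ g.
Proof.
rewrite -[LHS]dagK dagM /plusm -thom_dag -[thom _ _ _]/(f^† ⊕m g^†) P2_nat.
by rewrite dagM !dagK.
Qed.

Lemma P1_i2 (X Y : D) : (i1 X Y)^† ∘ i2 X Y = zero Y X.
Proof.
by rewrite /inj2 compA P1_nat -compA /zerom -!compA; congr (_ ∘ _); apply: toO_uniq.
Qed.

Lemma P2_i1 (X Y : D) : (i2 X Y)^† ∘ i1 X Y = zero X Y.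
Proof. by rewrite -[LHS]dagK dagM dagK P1_i2 dag0. Qed.

Lemma proj1_inj1 X Y : (j1 X Y)^† ∘ j1 X Y = Id X.
Proof. by rewrite -locF_dag -locFM P1_i1. Qed.
Lemma proj1_inj2 X Y : (j1 X Y)^† ∘ j2 X Y = zeroL Y X.
Proof. by rewrite -locF_dag -locFM P1_i2. Qed.
Lemma proj2_inj1 X Y : (j2 X Y)^† ∘ j1 X Y = zeroL X Y.
Proof. by rewrite -locF_dag -locFM P2_i1. Qed.
Lemma proj2_inj2 X Y : (j2 X Y)^† ∘ j2 X Y = Id Y.
Proof. by rewrite -locF_dag -locFM P2_i2. Qed.

Lemma lpair1 Z X Y (F : Z ⇝ X) (G : Z ⇝ Y) : (j1 X Y)^† ∘ lpair F G = F.
Proof. by rewrite /lpair; case: cid => K [[]]. Qed.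

Lemma lpair2 Z X Y (F : Z ⇝ X) (G : Z ⇝ Y) : (j2 X Y)^† ∘ lpair F G = G.
Proof. by rewrite /lpair; case: cid => K [[]]. Qed.

Lemma lpair_ext Z X Y (F G : Z ⇝ X ⊕ Y) :
  (j1 X Y)^† ∘ F = (j1 X Y)^† ∘ G -> (j2 X Y)^† ∘ F = (j2 X Y)^† ∘ G -> F = G.
Proof.
move=> e1 e2.
have [K [_ u]] := loc_product ((j1 X Y)^† ∘ F) ((j2 X Y)^† ∘ F).
by rewrite -(u F) // -(u G).
Qed.

Lemma lcopair1 Z X Y (F : X ⇝ Z) (G : Y ⇝ Z) : lcopair F G ∘ j1 X Y = F.
Proof. by rewrite -[LHS]dagK dagM /lcopair dagK lpair1 dagK. Qed.

Lemma lcopair2 Z X Y (F : X ⇝ Z) (G : Y ⇝ Z) : lcopair F G ∘ j2 X Y = G.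
Proof. by rewrite -[LHS]dagK dagM /lcopair dagK lpair2 dagK. Qed.

Lemma lcopair_ext Z X Y (F G : X ⊕ Y ⇝ Z) :
  F ∘ j1 X Y = G ∘ j1 X Y -> F ∘ j2 X Y = G ∘ j2 X Y -> F = G.
Proof.
move=> e1 e2; rewrite -[F]dagK -[G]dagK; congr (_^†).
by apply: lpair_ext; rewrite -!dagM ?e1 ?e2.
Qed.

Lemma lpairM W Z X Y (F : Z ⇝ X) (G : Z ⇝ Y) (H : W ⇝ Z) :
  lpair F G ∘ H = lpair (F ∘ H) (G ∘ H).
Proof. by apply: lpair_ext; rewrite compA ?lpair1 ?lpair2. Qed.

Lemma lpair_inj1 Z X Y (F : Z ⇝ X) : lpair F (zeroL Z Y) = j1 X Y ∘ F.
Proof.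
apply: lpair_ext; rewrite compA ?lpair1 ?lpair2.
  by rewrite proj1_inj1 comp1m.
by rewrite proj2_inj1 comp0L.
Qed.

Lemma lpair_inj2 Z X Y (G : Z ⇝ Y) : lpair (zeroL Z X) G = j2 X Y ∘ G.
Proof.
apply: lpair_ext; rewrite compA ?lpair1 ?lpair2.
  by rewrite proj1_inj2 comp0L.
by rewrite proj2_inj2 comp1m.
Qed.

Lemma plusm_lpair Z X X' Y Y' (f : X ~> X') (g : Y ~> Y') (F : Z ⇝ X) (G : Z ⇝ Y) :
  U (f ⊕m g) ∘ lpair F G = lpair (U f ∘ F) (U g ∘ G).
Proof.
apply: lpair_ext; rewrite compA ?lpair1 ?lpair2 -locF_dag -locFM ?P1_nat ?P2_nat.
  by rewrite (locFM f) locF_dag -compA lpair1.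
by rewrite (locFM g) locF_dag -compA lpair2.
Qed.

Lemma laddMr W X Y (F G : X ⇝ Y) (H : W ⇝ X) :
  ladd F G ∘ H = ladd (F ∘ H) (G ∘ H).
Proof. by rewrite /ladd -compA lpairM. Qed.

(** The codiagonal is natural: [H ∘ [1, 1] = [1, 1] ∘ (H ⊕ H)]. *)
Lemma laddMl X Y Z (H : Y ⇝ Z) (F G : X ⇝ Y) :
  H ∘ ladd F G = ladd (H ∘ F) (H ∘ G).
Proof.
pose HH := lpair (H ∘ (j1 Y Y)^†) (H ∘ (j2 Y Y)^†).
have HHE : H ∘ lcopair (Id Y) (Id Y) = lcopair (Id Z) (Id Z) ∘ HH.
  apply: lcopair_ext; rewrite -compA ?lcopair1 ?lcopair2 compm1 -compA lpairM.
    rewrite -!compA proj1_inj1 proj2_inj1 compm1 compL0 lpair_inj1 compA.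
    by rewrite lcopair1 comp1m.
  rewrite -!compA proj1_inj2 proj2_inj2 compm1 compL0 lpair_inj2 compA.
  by rewrite lcopair2 comp1m.
rewrite /ladd compA HHE -compA; congr (_ ∘ _).
by rewrite lpairM -!compA lpair1 lpair2.
Qed.

Lemma ladd0 X Y (F : X ⇝ Y) : ladd F (zeroL X Y) = F.
Proof. by rewrite /ladd lpair_inj1 compA lcopair1 comp1m. Qed.

Lemma ladd0l X Y (F : X ⇝ Y) : ladd (zeroL X Y) F = F.
Proof. by rewrite /ladd lpair_inj2 compA lcopair2 comp1m. Qed.

(** The Eckmann-Hilton interchange law, which holds because sums of pairs are
formed componentwise. Inserting zeros yields commutativity and associativity. *)
Lemma laddACA X Y (a b c d : X ⇝ Y) :
  ladd (ladd a b) (ladd c d) = ladd (ladd a c) (ladd b d).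
Proof.
transitivity (lcopair (Id Y) (Id Y) ∘ ladd (lpair a c) (lpair b d)).
  rewrite {1}/ladd; congr (_ ∘ _).
  by apply: lpair_ext; rewrite laddMl ?lpair1 ?lpair2.
by rewrite laddMl.
Qed.

Lemma laddC X Y (F G : X ⇝ Y) : ladd F G = ladd G F.
Proof.
by rewrite -{1}[F]ladd0l -{1}[G]ladd0 laddACA ladd0 ladd0l.
Qed.

Lemma laddA X Y (F G H : X ⇝ Y) : ladd F (ladd G H) = ladd (ladd F G) H.
Proof. by rewrite -{1}[F]ladd0 laddACA ladd0l. Qed.

Lemma lpairE Z X Y (F : Z ⇝ X) (G : Z ⇝ Y) :
  lpair F G = ladd (j1 X Y ∘ F) (j2 X Y ∘ G).
Proof.
apply: lpair_ext; rewrite laddMl !compA ?lpair1 ?lpair2.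
  by rewrite proj1_inj1 proj1_inj2 comp0L comp1m ladd0.
by rewrite proj2_inj1 proj2_inj2 comp0L comp1m ladd0l.
Qed.

Lemma lcopairE Z X Y (F : X ⇝ Z) (G : Y ⇝ Z) :
  lcopair F G = ladd (F ∘ (j1 X Y)^†) (G ∘ (j2 X Y)^†).
Proof.
apply: lcopair_ext; rewrite laddMr -!compA ?lcopair1 ?lcopair2.
  by rewrite proj1_inj1 proj2_inj1 compL0 compm1 ladd0.
by rewrite proj1_inj2 proj2_inj2 compL0 compm1 ladd0l.
Qed.

Lemma ladd_dag X Y (F G : X ⇝ Y) : (ladd F G)^† = ladd F^† G^†.
Proof.
have -> : (ladd F G)^† = lcopair F^† G^† ∘ lpair (Id Y) (Id Y).
  by rewrite /ladd dagM /lcopair !dag1 !dagK.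
by rewrite lcopairE laddMr -!compA lpair1 lpair2 !compm1.
Qed.

End Localised.

Section Scalars.
Variables (D : daggerRig) (HD : conditions D).
Local Open Scope dagcat_scope.

Local Notation compA := Defs.compA.
Local Notation frac := Defs.frac.
Local Notation zero X Y := (zerom (ax1 HD) X Y).
Local Notation "X ⇝ Y" := (Uob HD X ~> Uob HD Y) (at level 70, no associativity).
Local Notation U f := (locF HD f).
Local Notation i1 X Y := (inj1 (ax1 HD) X Y).
Local Notation i2 X Y := (inj2 (ax1 HD) X Y).
Local Notation Id X := (idm (Uob HD X)).
Local Notation zeroL X Y := (zeroL HD X Y).
Local Notation j1 X Y := (linj1 HD X Y).
Local Notation j2 X Y := (linj2 HD X Y).

(** * The involutive field of scalars *)

(** Conjugation by the unitary scalar [lunit ∘ runit^†] takes [s] to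
[s · idm]; the latter commutes with every scalar, so the conjugation is
trivial. *)
Lemma scale_id (s : rI ~> (rI : D)) : s · idm rI = s.
Proof.
pose l := lunit (rmul D) rI; pose r := runit (rmul D) rI.
have [lK Kl] : daggerIso l := lunit_iso (rmul D) rI.
have [rK Kr] : daggerIso r := runit_iso (rmul D) rI.
have central t : (s · idm rI) ∘ t = t ∘ (s · idm rI).
  by rewrite -scalel comp1m -scaler compm1.
have conj : (s · idm rI) ∘ (l ∘ r^†) = (l ∘ r^†) ∘ s.
  have sr : r^† ∘ s = (s ⊗m idm rI) ∘ r^†.
    rewrite -[LHS]compm1 -{1}Kr !compA; congr (_ ∘ _).
    by rewrite -compA -runit_nat compA rK comp1m.
  rewrite -(compA l) sr /scale -/l -!compA; congr (_ ∘ (_ ∘ _)).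
  by rewrite compA lK comp1m.
have vK : (r ∘ l^†) ∘ (l ∘ r^†) = idm rI.
  by rewrite compA -(compA r) lK compm1 Kr.
transitivity ((r ∘ l^†) ∘ ((l ∘ r^†) ∘ (s · idm rI))).
  by rewrite compA vK comp1m.
by rewrite -central conj compA vK comp1m.
Qed.

Lemma scalarC (s t : rI ~> (rI : D)) : s ∘ t = t ∘ s.
Proof.
by rewrite -{1}(scale_id s) -scalel comp1m -[t in LHS]compm1 scaler scale_id.
Qed.

Lemma lscalarC (s t : scalars HD) : s ∘ t = t ∘ s.
Proof.
rewrite -[s]num_den -[t]num_den [LHS]lcompE [RHS]lcompE; apply/fracE => /=.
by rewrite (scalarC (fnum s)) (scalarC (sval _) (sval (fden t))).
Qed.

(** The fraction [f/a] has inverse [a/f], as [f] does not vanish. *)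
Lemma lscalarV (s : scalars HD) : s <> zeroL rI rI -> exists t, t ∘ s = Id rI.
Proof.
rewrite -[s]num_den; set f := fnum s; set a := fden s => s0.
have f0 : f <> zero rI rI.
  by move=> e; apply: s0; rewrite e; apply/fracE; rewrite /= !scale0.
exists (frac (sval a) (NzScalar f0)).
rewrite [LHS]lcompE; apply/fracE => /=.
by rewrite scale1 scale_id scalarC.
Qed.

(** Well-pointedness, from [ax5] for [X ⊗ I]. *)
Lemma point_ext (X Y : D) (f g : X ~> Y) :
  (forall x : rI ~> X, f ∘ x = g ∘ x) -> f = g.
Proof.
move=> fg; have [_ rK] := runit_iso (rmul D) X.
rewrite -[f]compm1 -[g]compm1 -rK !compA; congr (_ ∘ _).
apply: (ax5 HD) => x y.
have -> : x ⊗m y = (x ⊗m idm rI) ∘ (idm rI ⊗m y).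
  by rewrite /tensm -thomM compm1 comp1m.
by rewrite !compA -!(compA _ (runit _ _)) runit_nat !compA fg.
Qed.

(** If the image of [f] is dense, in the sense that its dagger has no kernel,
then the equaliser of two maps that agree on [f] is the kernel of a map that
vanishes on [f], hence of zero. *)
Lemma epi_of_kernel (X Y : D) (f : X ~> Y) :
  (forall Z (w : Z ~> Y), f^† ∘ w = zero Z X -> w = zero Z Y) -> epi f.
Proof.
move=> ker0 Z g h gh.
have [E [n [[gn nP] dn]]] := ax6 HD g h.
have [k [nk _]] := nP _ _ gh.
have [W [w [wn wP]]] := ax7 HD dn; rewrite comp0m in wn.
have w0 : w = zero Y W.
  rewrite -[w]dagK -(dag0 HD W Y); congr (_^†); apply: ker0.
  by rewrite -dagM -nk compA wn comp0m dag0.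
have [k' [nk' _]] : exists! k : Y ~> E, n ∘ k = idm Y.
  by apply: wP; rewrite w0.
by rewrite -[g]compm1 -[h]compm1 -nk' !compA gn.
Qed.

(** Were the codiagonal of [I ⊕ I] to have no kernel, the diagonal would be
epic, which would identify the two projections. So some nonzero pair of scalars
sums to zero; dividing by a nonzero component gives the opposite of one. *)
Lemma opposite_one : exists m : scalars HD, ladd (Id rI) m = zeroL rI rI.
Proof.
pose nab : rI ⊕ rI ⇝ rI := lcopair (Id rI) (Id rI).
pose f : rI ⊕ rI ~> rI := fnum nab.
have fE : U (sval (fden nab) · idm rI) ∘ nab = U f := locF_den nab.
set k := U (sval (fden nab) · idm rI) in fE.
have nabE (w : rI ~> rI ⊕ rI) : f ∘ w = zero rI rI ->
    ladd (U ((i1 rI rI)^† ∘ w)) (U ((i2 rI rI)^† ∘ w)) = zeroL rI rI.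
  move=> fw; apply: (@locF_scaleI _ _ _ _ _ _ _ (proj2_sig (fden nab))).
  rewrite compL0 -/k; transitivity (U (f ∘ w)); last by rewrite fw.
  rewrite !locFM -fE -compA; congr (_ ∘ _).
  by rewrite /nab lcopairE laddMr !comp1m !locF_dag.
have [w [fw w0]] : exists w : rI ~> rI ⊕ rI, f ∘ w = zero rI rI /\
    w <> zero rI (rI ⊕ rI).
  apply: contrapT => no.
  have ker0 Z (z : Z ~> rI ⊕ rI) : f ∘ z = zero Z rI -> z = zero Z (rI ⊕ rI).
    move=> fz; apply: point_ext => x; rewrite comp0m; apply: contrapT => zx.
    by apply: no; exists (z ∘ x); rewrite compA fz comp0m.
  have epif : epi f^† by apply: epi_of_kernel => Z z; rewrite dagK; exact: ker0.
  suff P12 : (i1 rI rI)^† = (i2 rI rI)^†.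
    by apply: (@id_neq0 _ HD); rewrite -(P1_i1 HD rI rI) P12 P2_i1.
  apply: epif; rewrite -!dagM; congr (_^†).
  apply: (@locF_inj _ HD); rewrite !(locFM HD f) -fE -!compA; congr (_ ∘ _).
  by rewrite -[U (i1 _ _)]/(j1 rI rI) -[U (i2 _ _)]/(j2 rI rI) /nab lcopair1 lcopair2.
have fw0 := nabE _ fw.
set a := U (_ ∘ w) in fw0; set b := U (_ ∘ w) in fw0.
have [a0|a0] := pselect (a = zeroL rI rI).
  have b0 : b = zeroL rI rI by rewrite -fw0 a0 ladd0l.
  case: w0; apply: (@locF_inj _ HD); apply: lpair_ext.
    by rewrite -locF_dag -!locFM compm0.
  by rewrite -locF_dag -!locFM compm0.
have [t ta] := lscalarV a0.
by exists (t ∘ b); rewrite -ta -laddMl fw0 compL0.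
Qed.

End Scalars.

(** [scalars HD] under a name of its own, to carry the field structure. *)
Definition scalarField (D : daggerRig) (HD : conditions D) : Type := scalars HD.

Section ScalarField.
Variables (D : daggerRig) (HD : conditions D).
Local Notation K := (scalarField HD).
Local Open Scope dagcat_scope.

HB.instance Definition _ := gen_eqMixin K.
HB.instance Definition _ := gen_choiceMixin K.

Definition scalar_opp (s : K) : K := Defs.comp (projT1 (cid (opposite_one HD))) s.

Lemma scalar_addNr :
  left_inverse (zeroL HD rI rI : K) scalar_opp (fun s t : K => ladd s t).
Proof.
move=> s; rewrite /scalar_opp; case: cid => m /= m1.
by rewrite laddC -{1}[s]comp1m -laddMr m1 comp0L.
Qed.

HB.instance Definition _ := GRing.isZmodule.Build K
  (fun s t u : K => laddA s t u) (fun s t : K => laddC s t)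
  (fun s : K => ladd0l s) scalar_addNr.

Lemma scalar_mulrDl : left_distributive (fun s t : K => s ∘ t : K) +%R.
Proof. by move=> s t u; rewrite laddMr. Qed.

Lemma scalar_one_neq0 : (idm (Uob HD rI) : K) != 0%R.
Proof. by apply/eqP => /locF_inj /id_neq0. Qed.

HB.instance Definition _ := GRing.Zmodule_isComNzRing.Build K
  (fun s t u : K => Defs.compA s t u) (fun s t : K => lscalarC s t)
  (fun s : K => comp1m s) scalar_mulrDl scalar_one_neq0.

Definition scalar_inv (s : K) : K :=
  if pselect (s = zeroL HD rI rI) is right s0 then projT1 (cid (lscalarV s0))
  else 0%R.

Lemma scalar_mulVf (s : K) : s != 0%R -> (scalar_inv s * s = 1)%R.
Proof.
rewrite /scalar_inv; case: pselect => [-> /eqP //|s0 _].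
by case: cid.
Qed.

Lemma scalar_inv0 : scalar_inv 0%R = 0%R.
Proof. by rewrite /scalar_inv; case: pselect. Qed.

HB.instance Definition _ := GRing.ComNzRing_isField.Build K scalar_mulVf scalar_inv0.

End ScalarField.

Section Norms.
Variables (D : daggerRig) (HD : conditions D).
Local Open Scope dagcat_scope.

Local Notation compA := Defs.compA.
Local Notation frac := Defs.frac.
Local Notation zero X Y := (zerom (ax1 HD) X Y).
Local Notation "X ⇝ Y" := (Uob HD X ~> Uob HD Y) (at level 70, no associativity).
Local Notation U f := (locF HD f).
Local Notation i1 X Y := (inj1 (ax1 HD) X Y).
Local Notation i2 X Y := (inj2 (ax1 HD) X Y).
Local Notation Id X := (idm (Uob HD X)).
Local Notation zeroL X Y := (zeroL HD X Y).
Local Notation j1 X Y := (linj1 HD X Y).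
Local Notation j2 X Y := (linj2 HD X Y).
Local Notation K := (scalarField HD).

(** * Norms, positive scalars and contractive scalars *)

Definition sconj (s : K) : K := s^†.

Lemma sconjK : involutive sconj. Proof. exact: dagK. Qed.
Lemma sconjD s t : sconj (s + t)%R = (sconj s + sconj t)%R.
Proof. exact: ladd_dag. Qed.
Lemma sconjM s t : sconj (s * t)%R = (sconj s * sconj t)%R.
Proof. by rewrite mulrC; apply: dagM. Qed.
Lemma sconj1 : sconj 1%R = 1%R. Proof. exact: dag1. Qed.

Lemma scalar_mulE (s t : K) : s ∘ t = (s * t)%R. Proof. by []. Qed.
(** In Hilbert spaces this is the square of the usual norm; it is called the norm
of [x] in the comments below. *)
Definition norm2 X (x : rI ⇝ X) : K := x^† ∘ x.

Lemma conj_norm2 X (x : rI ⇝ X) : sconj (norm2 x) = norm2 x.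
Proof. by rewrite /sconj /norm2 dagM dagK. Qed.

Lemma norm2M X (x : rI ⇝ X) (s : K) : norm2 (x ∘ s) = (sconj s * norm2 x * s)%R.
Proof. by rewrite /norm2 dagM compA -(compA s^†). Qed.

Lemma norm2_isom X Y (F : X ⇝ Y) (x : rI ⇝ X) :
  F^† ∘ F = Id X -> norm2 (F ∘ x) = norm2 x.
Proof. by move=> FF; rewrite /norm2 dagM compA -(compA _ F^†) FF compm1. Qed.

Lemma norm2_pair X Y (x : rI ⇝ X) (y : rI ⇝ Y) :
  norm2 (lpair x y) = (norm2 x + norm2 y)%R.
Proof.
rewrite /norm2 {1}lpairE ladd_dag !dagM laddMr -!compA lpair1 lpair2.
by [].
Qed.

(** By assumption [f] factors as [e ∘ k] through the dagger monic kernel [e] of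
[f^†], so that [k = e^† ∘ f = (f^† ∘ e)^†] vanishes. *)
Lemma dag_comp_eq0 (X Y : D) (f : X ~> Y) : f^† ∘ f = zero X X -> f = zero X Y.
Proof.
move=> ff; have [E [e [[fe eP] de]]] := ax6 HD f^† (zero Y X).
have [k [ek _]] : exists! k : X ~> E, e ∘ k = f.
  by apply: eP; rewrite ff comp0m.
have k0 : k = (f^† ∘ e)^† by rewrite dagM dagK -{1}ek compA de comp1m.
by rewrite -ek k0 fe comp0m dag0 compm0.
Qed.

Lemma norm2_eq0 X (x : rI ⇝ X) : norm2 x = 0%R -> x = zeroL rI X.
Proof.
rewrite -[x]num_den; move: (fnum x) (fden x) => f a.
have -> : norm2 (frac f a) = frac (f^† ∘ f) (nzMul (nzDag a) a).
  by rewrite /norm2 [X in X ∘ _]ldagE [LHS]lcompE.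
move=> /fracE /=; rewrite scale1 scale0 => ff.
rewrite (dag_comp_eq0 ff); apply/fracE; rewrite /= !scale0; exact: erefl.
Qed.

Lemma norm2_zero X : norm2 (zeroL rI X) = 0%R.
Proof. by rewrite /norm2 compL0. Qed.

Definition Pos (s : K) : Prop := exists (X : D) (x : rI ⇝ X), s = norm2 x.

(** The scalars realised as norms by morphisms of [D] itself; they turn out to
be the positive scalars below one. *)
Definition Con (s : K) : Prop := exists (X : D) (x : rI ~> X), s = norm2 (U x).

Lemma Con_Pos s : Con s -> Pos s.
Proof. by move=> [X [x ->]]; exists X, (U x). Qed.

Lemma Pos_conj s : Pos s -> sconj s = s.
Proof. by move=> [X [x ->]]; apply: conj_norm2. Qed.

Lemma Pos_sq (s : K) : Pos (sconj s * s)%R.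
Proof. by exists rI, s. Qed.

Lemma Pos0 : Pos 0%R.
Proof. by have := Pos_sq 0%R; rewrite mulr0. Qed.

Lemma Pos1 : Pos 1%R.
Proof. by have := Pos_sq 1%R; rewrite sconj1 mulr1. Qed.

Lemma PosD s t : Pos s -> Pos t -> Pos (s + t)%R.
Proof.
by move=> [X [x ->]] [Y [y ->]]; exists (X ⊕ Y), (lpair x y); rewrite norm2_pair.
Qed.

(** If norms of [x] and [y] sum to zero, then the point [(x, y)] vanishes. *)
Lemma Pos_anti s : Pos s -> Pos (- s)%R -> s = 0%R.
Proof.
move=> [X [x xE]] [Y [y yE]].
have : norm2 (lpair x y) = 0%R by rewrite norm2_pair -xE -yE subrr.
move=> /norm2_eq0 xy0; rewrite xE.
by rewrite -[x](lpair1 x y) xy0 compL0 norm2_zero.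
Qed.

(** Tensoring with a point of [Y] multiplies norms by that of the point. *)
Definition ltens (X Y : D) (y : rI ~> Y) : X ~> Y ⊗ X :=
  (y ⊗m idm X) ∘ (lunit (rmul D) X)^†.

Lemma ltens_dag X Y (y : rI ~> Y) :
  (ltens X y)^† ∘ ltens X y = (y^† ∘ y) · idm X.
Proof.
rewrite /ltens dagM dagK -!compA /scale -compA; congr (_ ∘ _).
by rewrite compA /tensm -thom_dag -thomM dag1 comp1m.
Qed.

Lemma scale_point (s : rI ~> rI) X (x : rI ⇝ X) : U (s · idm X) ∘ x = x ∘ U s.
Proof. by rewrite locF_scaleC scale_id. Qed.

Lemma norm2_ltens X Y (y : rI ~> Y) (x : rI ⇝ X) :
  norm2 (U (ltens X y) ∘ x) = (norm2 (U y) * norm2 x)%R.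
Proof.
rewrite /norm2 dagM compA -(compA x^†) -locF_dag -locFM ltens_dag -compA.
by rewrite scale_point compA scalar_mulE mulrC locFM locF_dag.
Qed.

(** The product of the norms of [x] and [y] is the norm of [y ⊗ x], up to the
denominator of [y]. *)
Lemma PosM s t : Pos s -> Pos t -> Pos (s * t)%R.
Proof.
move=> [X [x ->]] [Y [y ->]].
pose a : K := frac (idm rI) (fden y).
have yE : y = U (fnum y) ∘ a.
  rewrite -{1}[y]num_den [RHS]lcompE; apply/fracE.
  by rewrite /= compm1 comp1m.
exists (Y ⊗ X), (U (ltens X (fnum y)) ∘ x ∘ a).
by rewrite [in LHS]yE !norm2M norm2_ltens; ring.
Qed.

Lemma PosV s : Pos s -> Pos s^-1%R.
Proof.
move=> Ps; have [->|s0] := eqVneq s 0%R; first by rewrite invr0; exact: Pos0.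
have -> : (s^-1 = s * (sconj s^-1 * s^-1))%R.
  have -> : sconj s^-1 = (s^-1)%R.
    apply: (mulfI s0); rewrite divff // -[X in (X * _)%R](Pos_conj Ps) -sconjM.
    by rewrite divff // sconj1.
  by rewrite mulVKf.
by apply: PosM => //; exact: Pos_sq.
Qed.

Lemma conjV s : Pos s -> sconj s^-1 = s^-1%R.
Proof. by move=> /PosV /Pos_conj. Qed.

(** * Isometries of the localisation *)

Lemma locF_isometry (X Y : D) (m : X ~> Y) : daggerMono m -> (U m)^† ∘ U m = Id X.
Proof. by move=> dm; rewrite -locF_dag -locFM dm. Qed.

(** The range of the projection [p = f/a] is the equaliser of [f] and [a · idm]. *)
Lemma split_projection X (p : X ⇝ X) : p^† = p -> p ∘ p = p ->
  exists Z (m : Z ~> X), daggerMono m /\ U m ∘ (U m)^† = p.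
Proof.
move=> pd pp; pose f : X ~> X := fnum p; pose a := sval (fden p).
have a0 : a <> zero rI rI := proj2_sig (fden p).
have fE : U f = U (a · idm X) ∘ p by rewrite -locF_den.
have pf : p ∘ U f = U f by rewrite fE locF_scaleC compA pp.
have [E [e [[fe eP] de]]] := ax6 HD f (a · idm X).
have pe : p ∘ U e = U e.
  by apply: (locF_scaleI a0); rewrite compA -fE -!locFM fe.
have [k [ek _]] : exists! k : X ~> E, e ∘ k = f.
  apply: eP; apply: (@locF_inj _ HD); rewrite (locFM HD f) (locFM HD (_ · _)).
  by rewrite {1}fE -compA pf.
have ep : (U e)^† ∘ p = (U e)^† by rewrite -{1}pd -dagM pe.
have ee := locF_isometry de.
exists E, e; split=> //; rewrite -ep compA.
apply: (locF_scaleI a0); rewrite -fE compA locF_scaleC -compA -fE -ek.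
by rewrite (locFM HD e) -!compA (compA _ (U e)) ee comp1m.
Qed.

(** The isomorphism [f] relates the epimorphisms [idm] and [f], which have equal
[x^† ∘ x] by [ax8]. *)
Lemma iso_unitary (X Y : D) (f : X ~> Y) : isIso f -> f^† ∘ f = idm X.
Proof.
move=> fi; have [g [gf fg]] := fi.
have epi1 : epi (idm X) by move=> Z h k; rewrite !compm1.
have epif : epi f.
  by move=> Z h k hk; rewrite -[h]compm1 -[k]compm1 -fg !compA hk.
have [_ /(_ _) <-] := ax8 HD epi1 epif; first by rewrite dag1 comp1m.
by exists f; split=> //; rewrite compm1.
Qed.

(** Clearing denominators turns a unitary [f/a] into two epimorphisms [f] and
[a · idm] with the same [x^† ∘ x]; these differ by an isomorphism of [D]. *)
Lemma unitary_lift X Y (u : X ⇝ Y) : u^† ∘ u = Id X -> u ∘ u^† = Id Y ->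
  exists g : X ~> Y, u = U g.
Proof.
move=> uu uu'; pose f : X ~> Y := fnum u; pose a := sval (fden u).
have a0 : a <> zero rI rI := proj2_sig (fden u).
have fE : U f = U (a · idm Y) ∘ u by rewrite -locF_den.
have fE' : U f = u ∘ U (a · idm X) by rewrite fE locF_scaleC.
have epia : epi (a · idm X).
  by move=> Z g h; rewrite -!scaler !compm1; exact: scaleI.
have epif : epi f.
  move=> Z g h gh; apply: (@locF_inj _ HD); apply: (locF_scaleI a0).
  rewrite !locF_scaleC.
  rewrite -[U (a · idm Y)]compm1 -uu' (compA _ u) -fE !compA -!locFM gh.
  by rewrite locFM.
have [g [gi fg]] : exists g : X ~> Y, isIso g /\ f = g ∘ (a · idm X).
  apply/(ax8 HD epia epif); apply: (@locF_inj _ HD).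
  rewrite (locFM HD f^†) (locFM HD _^†) !locF_dag.
  by rewrite fE' dagM -compA (compA u^†) uu comp1m.
exists g; apply: (locF_scaleI a0); rewrite -fE fg locF_scaleC.
by rewrite (locFM HD g).
Qed.

(** The range projection [u ∘ u^†] splits through a dagger monomorphism [m] of
[D], and [(U m)^† ∘ u] is unitary. *)
Lemma isometry_lift X Y (u : X ⇝ Y) : u^† ∘ u = Id X ->
  exists g : X ~> Y, u = U g.
Proof.
move=> uu.
have [||Z [m [dm mE]]] := @split_projection Y (u ∘ u^†).
- by rewrite dagM dagK.
- by rewrite compA -(compA u) uu compm1.
have mm := locF_isometry dm.
have mu : U m ∘ ((U m)^† ∘ u) = u by rewrite compA mE -compA uu compm1.
have [||g gE] := @unitary_lift X Z ((U m)^† ∘ u).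
- by rewrite dagM dagK -compA mu.
- by rewrite dagM dagK compA -(compA _ u) -mE -!compA mm compm1.
by exists (m ∘ g); rewrite -[LHS]mu gE -locFM.
Qed.

(** * Comparison of positive scalars by factorisation *)

(** If [x] and [y] have norms [s] and [1 - s], then [(x, y)] is an isometry, and
[x] is its first component. *)
Lemma Con_le1 s : Pos s -> Pos (1 - s)%R -> Con s.
Proof.
move=> [X [x xE]] [Y [y yE]].
have [|g gE] := @isometry_lift rI (X ⊕ Y) (lpair x y).
  by rewrite -[LHS]/(norm2 _) norm2_pair -xE -yE addrC subrK.
exists X, ((i1 X Y)^† ∘ g).
by rewrite xE -{1}[x](lpair1 x y) gE (locFM HD _ g) locF_dag.
Qed.

Lemma ConM s t : Con s -> Con t -> Con (s * t)%R.
Proof.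
move=> [X [x ->]] [Y [y ->]]; exists (X ⊗ Y), (ltens Y x ∘ y).
by rewrite (locFM HD _ y) norm2_ltens.
Qed.

(** Then [s] and its inverse both come from [D], so [s] is an isomorphism of [D],
hence unitary, and [s ^ 2 = 1]. *)
Lemma Con_anti s : s != 0%R -> Con s -> Con s^-1%R -> s = 1%R.
Proof.
move=> s0 cs; have ps := Con_Pos cs.
have [X [x xE]] := cs => -[Y [y yE]].
have iso : isIso (x^† ∘ x).
  have xy : (x^† ∘ x) ∘ (y^† ∘ y) = idm rI.
    apply: (@locF_inj _ HD); rewrite (locFM HD (x^† ∘ x)) !locFM !locF_dag.
    rewrite -[_ ∘ _ ∘ _]/((norm2 (U x)) ∘ (norm2 (U y))) -xE -yE.
    by rewrite -[LHS]/(s * s^-1)%R divff.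
  by exists (y^† ∘ y); rewrite xy scalarC xy.
have /eqP := congr1 (fun f => U f : K) (iso_unitary iso).
rewrite dagM dagK !locFM !locF_dag -[_ ∘ _ ∘ _]/((norm2 (U x)) ∘ (norm2 (U x))) -xE.
rewrite -[X in X == _]/(s * s)%R -[X in _ == X]/(1%R : K) -expr2 sqrf_eq1.
case/orP=> /eqP // sN; case/eqP: (oner_neq0 K).
by apply: (Pos_anti Pos1); rewrite -sN.
Qed.

Lemma Con1 : Con 1%R.
Proof. by apply: Con_le1; [exact: Pos1|rewrite subrr; exact: Pos0]. Qed.

(** The image of [y] is the range of the projection [y ∘ p^-1 ∘ y^†], where [p] is
the norm of [y]. *)
Lemma point_image X (y : rI ~> X) : norm2 (U y) != 0%R ->
  exists Z (m : Z ~> X) (x : rI ~> Z), [/\ daggerMono m, y = m ∘ x & epi x].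
Proof.
move=> p0; set p := norm2 (U y) in p0.
have yp : (U y)^† ∘ U y ∘ p^-1%R = Id rI by exact: (divff p0).
have pd : (p^-1%R : K)^† = p^-1%R by apply: conjV; exists X, (U y).
have [||Z [m [dm mE]]] := @split_projection X (U y ∘ (p^-1%R : K) ∘ (U y)^†).
- by rewrite !dagM dagK pd compA.
- by rewrite !compA; congr (_ ∘ _); rewrite -!compA (compA (U y)^†) yp compm1.
have mm := locF_isometry dm.
have my : U m ∘ (U m)^† ∘ U y = U y.
  rewrite mE -!compA.
  have -> : (p^-1%R : K) ∘ ((U y)^† ∘ U y) = Id rI by exact: (mulVf p0).
  exact: compm1.
exists Z, m, (m^† ∘ y); split=> //.
  by apply: (@locF_inj _ HD); rewrite compA (locFM HD (m ∘ _)) locFM locF_dag.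
move=> W g h gh; apply: (@locF_inj _ HD).
have K : U (m^† ∘ y) ∘ ((p^-1%R : K) ∘ (U y)^† ∘ U m) = Id Z.
  rewrite (locFM HD _ y) locF_dag.
  transitivity ((U m)^† ∘ (U y ∘ (p^-1%R : K) ∘ (U y)^†) ∘ U m).
    by rewrite -!compA.
  by rewrite -mE -!compA mm compm1 mm.
by rewrite -[U g]compm1 -[U h]compm1 -K !compA -!locFM gh.
Qed.

(** The order given by factorisation in [D], see [factor_of_below]. It agrees with
that of the cone [Pos] by [below_Pos_sub] and [Pos_sub_below]. *)
Definition below (s t : K) : Prop := exists2 e, Con e & s = (e * t)%R.

Lemma below_trans t s u : below s t -> below t u -> below s u.
Proof.
by move=> [e Ce ->] [e' Ce' ->]; exists (e * e')%R; rewrite ?mulrA //; exact: ConM.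
Qed.

Lemma below_anti s t : below s t -> below t s -> s = t.
Proof.
move=> [e Ce se] [e' Ce' te].
have [t0|t0] := eqVneq t 0%R; first by rewrite se t0 mulr0.
have ee : (e' * e = 1)%R.
  by apply: (mulIf t0); rewrite mul1r -mulrA -se -te.
have e0 : e != 0%R by apply: contraNneq (oner_neq0 K) => e0; rewrite -ee e0 mulr0.
have e'E : e' = e^-1%R by apply: (mulIf e0); rewrite ee mulVf.
by rewrite se (Con_anti e0) ?mul1r // -e'E.
Qed.

Lemma locF_norm2_eq0 X (x : rI ~> X) : norm2 (U x) = 0%R -> x = zero rI X.
Proof. by move=> /norm2_eq0 x0; apply: (@locF_inj _ HD). Qed.

(** If [y] has [e] times the norm of [x], where [e] is the norm of [z], then
[y] and [ltens X z ∘ x] have equal norms, so that their images are isomorphic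
under the origin. *)
Lemma factor_of_below X Y (x : rI ~> X) (y : rI ~> Y) :
  below (norm2 (U y)) (norm2 (U x)) -> exists h : X ~> Y, y = h ∘ x.
Proof.
move=> [e [Z [z zE]] yE].
have [y0|y0] := eqVneq (norm2 (U y)) 0%R.
  by exists (zero X Y); rewrite comp0m (locF_norm2_eq0 y0).
have wE : norm2 (U (ltens X z ∘ x)) = norm2 (U y).
  by rewrite (locFM HD _ x) norm2_ltens -zE -yE.
have [A [m [y' [dm ym ey]]]] := point_image y0.
move: (y0); rewrite -wE => w0.
have [B [n [w' [dn wn ew]]]] := point_image w0.
have [f [_ fw]] : exists f : B ~> A, isIso f /\ y' = f ∘ w'.
  apply/(ax8 HD ew ey); apply: (@locF_inj _ HD).
  rewrite !(locFM HD _^†) !locF_dag -![_^† ∘ _]/(norm2 _).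
  rewrite -(norm2_isom _ (locF_isometry dn)) -(norm2_isom _ (locF_isometry dm)).
  by rewrite -(locFM HD n) -(locFM HD m) -wn -ym.
exists (m ∘ f ∘ n^† ∘ ltens X z).
by rewrite -compA wn -!compA (compA n^†) dn comp1m -fw.
Qed.

(** Normalising [x ⊗ x] gives an isometry into [X ⊗ X], which turns [h ⊗ idm]
into a point with the required norm. *)
Lemma below_of_factor X Y (x : rI ~> X) (h : X ~> Y) :
  norm2 (U x) != 0%R -> below (norm2 (U (h ∘ x))) (norm2 (U x)).
Proof.
move=> p0; set p := norm2 (U x) in p0 *.
have pV : sconj p^-1%R = p^-1%R by apply: conjV; exists X, (U x).
have [|u uE] := @isometry_lift rI (X ⊗ X) (U (ltens X x) ∘ U x ∘ (p^-1%R : K)).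
  rewrite -[LHS]/(norm2 _) norm2M norm2_ltens -/p pV.
  by rewrite mulrA mulVf // mul1r mulfV.
exists (norm2 (U ((h ⊗m idm X) ∘ u))); first by exists (Y ⊗ X), ((h ⊗m idm X) ∘ u).
have hx : (h ⊗m idm X) ∘ ltens X x = ltens X (h ∘ x).
  by rewrite /ltens compA /tensm -thomM comp1m.
rewrite (locFM HD _ u) -uE !compA -(locFM HD (h ⊗m _)) hx norm2M norm2_ltens pV.
by rewrite -/p mulrCA -!mulrA mulVf // mulr1 mulVf // mulr1.
Qed.

(** * Infima as colimits *)

Definition isInf (p : nat -> K) (t : K) : Prop :=
  (forall n, below t (p n)) /\ forall s, (forall n, below s (p n)) -> below s t.

Lemma isInf_uniq p t u : isInf p t -> isInf p u -> t = u.
Proof. by move=> [tp tP] [up uP]; apply: below_anti; auto. Qed.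

Lemma isInfM c p t : c != 0%R -> isInf p t -> isInf (fun n => c * p n)%R (c * t)%R.
Proof.
move=> c0; have bM s u : below s u -> below (c * s)%R (c * u)%R.
  by move=> [e Ce ->]; exists e => //; rewrite mulrCA.
move=> [tp tP]; split=> [n|s sp]; first exact/bM.
suff : below (c^-1 * s)%R t by move=> /bM; rewrite mulVKf.
by apply: tP => n; have [e Ce ->] := sp n; exists e => //; rewrite mulrCA mulKf.
Qed.

Lemma cocone_point (X : nat -> D) (f : forall n, X n ~> X n.+1) L
    (c : forall n, X n ~> L) (x : forall n, rI ~> X n) :
  (forall n, f n ∘ x n = x n.+1) -> isCocone f c ->
  forall n, c n ∘ x n = c 0%N ∘ x 0%N.
Proof.
by move=> fx cf; elim=> // n IH; rewrite -fx compA cf.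
Qed.

Lemma colimit_ext (X : nat -> D) (f : forall n, X n ~> X n.+1) L
    (c : forall n, X n ~> L) W (g h : L ~> W) : isColimit f c ->
  (forall n, g ∘ c n = h ∘ c n) -> g = h.
Proof.
move=> [cf cP] gh; have [|k [_ ku]] := cP W (fun n => g ∘ c n).
  by move=> n; rewrite -compA cf.
by rewrite -(ku g) // -(ku h).
Qed.

(** A lower bound of the norms of the [x n] is the norm of a point [y] that factors
through every [x n]; the factors form a cocone, as the [x n] are epic. *)
Lemma colimit_isInf (X : nat -> D) (f : forall n, X n ~> X n.+1) L
    (c : forall n, X n ~> L) (x : forall n, rI ~> X n) :
  (forall n, f n ∘ x n = x n.+1) -> (forall n, epi (x n)) ->
  (forall n, norm2 (U (x n)) != 0%R) -> isColimit f c ->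
  isInf (fun n => norm2 (U (x n))) (norm2 (U (c 0%N ∘ x 0%N))).
Proof.
move=> fx ex x0 cc; have [cf cP] := cc; split=> [n|s sp].
  by rewrite -(cocone_point fx cf n); exact: below_of_factor.
have [Y [y yE]] : Con s.
  have [e Ce ->] := sp 0%N; apply: ConM => //; by exists (X 0%N), (x 0%N).
have hex n : exists h : X n ~> Y, y = h ∘ x n.
  by apply: factor_of_below; rewrite -yE.
pose h n := projT1 (cid (hex n)).
have hE n : y = h n ∘ x n := projT2 (cid (hex n)).
have [|k [kE _]] := cP Y h.
  by move=> n; apply: (ex n); rewrite -compA fx -!hE.
have ykx : y = k ∘ (c 0%N ∘ x 0%N) by rewrite compA kE.
have [t0|t0] := eqVneq (norm2 (U (c 0%N ∘ x 0%N))) 0%R.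
  exists 1%R; first exact: Con1.
  rewrite t0 mulr0 yE ykx (locF_norm2_eq0 t0) compm0.
  exact: norm2_zero.
by rewrite yE ykx; exact: below_of_factor.
Qed.

Lemma epi_of_comp (X Y Z : D) (g : Y ~> Z) (f : X ~> Y) : epi (g ∘ f) -> epi g.
Proof. by move=> e W h k hk; apply: e; rewrite !compA hk. Qed.

Lemma epi_plusm (X X' Y Y' : D) (f : X ~> X') (g : Y ~> Y') :
  epi f -> epi g -> epi (f ⊕m g).
Proof.
move=> ef eg Z h k hk; apply: (ax2 (c0 := HD)).
  by apply: ef; rewrite -(compA h) -(compA k) -(i1_nat HD f g) !compA hk.
by apply: eg; rewrite -(compA h) -(compA k) -(i2_nat HD f g) !compA hk.
Qed.

(** Images of points with the given norms; the maps between them exist by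
[factor_of_below]. *)
Lemma decreasing_diagram (p : nat -> K) :
  (forall n, Con (p n)) -> (forall n, p n != 0%R) ->
  (forall n, below (p n.+1) (p n)) ->
  exists (X : nat -> D) (x : forall n, rI ~> X n) (f : forall n, X n ~> X n.+1),
    [/\ forall n, norm2 (U (x n)) = p n, forall n, epi (x n)
      & forall n, f n ∘ x n = x n.+1].
Proof.
move=> Cp p0 dp.
have exX n : exists (X : D) (x : rI ~> X), norm2 (U x) = p n /\ epi x.
  have [Y [y yE]] := Cp n.
  have [|Z [m [x [dm ym ex]]]] := @point_image Y y; first by rewrite -yE.
  exists Z, x; split=> //; rewrite yE ym (locFM HD m) norm2_isom //.
  exact: locF_isometry.
pose X n := projT1 (cid (exX n)).
have exx n : exists x : rI ~> X n, norm2 (U x) = p n /\ epi x := projT2 (cid (exX n)).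
pose x n := projT1 (cid (exx n)).
have xP n : norm2 (U (x n)) = p n /\ epi (x n) := projT2 (cid (exx n)).
have exf n : exists f : X n ~> X n.+1, x n.+1 = f ∘ x n.
  by apply: factor_of_below; have [-> _] := xP n; have [-> _] := xP n.+1.
exists X, x, (fun n => projT1 (cid (exf n))).
by split=> n; have [] := xP n => // _ _; case: cid.
Qed.

Lemma decreasing_below0 (p : nat -> K) n :
  (forall n, below (p n.+1) (p n)) -> below (p n) (p 0%N).
Proof.
move=> dp; elim: n => [|n IH]; last exact: below_trans IH.
by exists 1%R; [exact: Con1|rewrite mul1r].
Qed.

Lemma belowM c s t : below s t -> below (c * s)%R (c * t)%R.
Proof. by move=> [e Ce ->]; exists e => //; rewrite mulrCA. Qed.

Lemma isInf_exists (p : nat -> K) :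
  (forall n, Pos (p n)) -> (forall n, p n != 0%R) ->
  (forall n, below (p n.+1) (p n)) -> exists2 t, Pos t & isInf p t.
Proof.
move=> Pp p0 dp; pose q n := ((p 0%N)^-1 * p n)%R.
have dq n : below (q n.+1) (q n) by apply: belowM.
have q0 n : q n != 0%R by rewrite mulf_neq0 ?invr_eq0.
have Cq n : Con (q n).
  have [e Ce qe] := decreasing_below0 n dq.
  by rewrite qe /q mulVf // mulr1.
have [X [x [f [xE ex fx]]]] := decreasing_diagram Cq q0 dq.
have ef n : epi (f n) by apply: (@epi_of_comp _ _ _ _ (x n)); rewrite fx.
have [L [c cc]] := ax9_colim HD ef.
have tI : isInf (fun n => norm2 (U (x n))) (norm2 (U (c 0%N ∘ x 0%N))).
  by apply: colimit_isInf fx ex _ cc => n; rewrite xE.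
set t := norm2 _ in tI *.
exists (p 0%N * t)%R; first by apply: PosM => //; exists L, (U (c 0%N ∘ x 0%N)).
have := isInfM (p0 0%N) tI; congr isInf.
by apply/funext => n; rewrite xE mulVKf.
Qed.

Lemma norm2_ladd X (a b : rI ⇝ X) :
  a^† ∘ b = zeroL rI rI -> norm2 (ladd a b) = (norm2 a + norm2 b)%R.
Proof.
move=> ab; have ba : b^† ∘ a = zeroL rI rI.
  by rewrite -[LHS]dagK dagM dagK ab dag0L.
rewrite /norm2 ladd_dag laddMr !laddMl ab ba.
by rewrite ladd0 ladd0l.
Qed.

(** The sign change [idm ⊕ -idm] is compatible with the diagram [X n ⊕ Y], so
it acts on its colimit [M]. The action fixes [a], negates [b] and is unitary,
being an isomorphism; so [a] and [b] are orthogonal. *)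
Lemma colimit_orth (X : nat -> D) (f : forall n, X n ~> X n.+1) Y M
    (e : forall n, X n ⊕ Y ~> M) (x : rI ~> X 0%N) (y : rI ~> Y) :
  isColimit (fun n => f n ⊕m idm Y) e ->
  (U (e 0%N ∘ (i1 (X 0%N) Y ∘ x)))^† ∘ U (e 0%N ∘ (i2 (X 0%N) Y ∘ y)) = zeroL rI rI.
Proof.
move=> ee; have [ec eP] := ee.
set a := e 0%N ∘ _; set b := e 0%N ∘ _.
have [s sE] : exists s : rI ~> rI, (-1 : K)%R = U s.
  apply: isometry_lift; rewrite -[LHS]/(sconj (-1) * -1)%R.
  have : (sconj (-1) + 1 = 0)%R.
    by rewrite -[X in (_ + X)%R]sconj1 -sconjD addNr; exact: dag0L.
  move=> /eqP; rewrite addr_eq0 => /eqP ->.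
  by rewrite mulrNN mulr1.
have ss : s ∘ s = idm rI.
  by apply: (@locF_inj _ HD); rewrite locFM -sE scalar_mulE mulrNN mulr1.
pose th n : X n ⊕ Y ~> X n ⊕ Y := idm (X n) ⊕m (s · idm Y).
have thth n : th n ∘ th n = idm (X n ⊕ Y).
  rewrite /th /plusm -thomM comp1m -scaleM ss scale1 comp1m.
  exact: thom1.
have [|t [tE _]] := eP M (fun n => e n ∘ th n).
  move=> n; rewrite -(ec n) -!compA; congr (_ ∘ _).
  by rewrite /th /plusm -!thomM !comp1m compm1 compm1.
have tt : t ∘ t = idm M.
  apply: (colimit_ext ee) => n.
  by rewrite -compA tE compA tE -compA thth compm1 comp1m.
have tu : t^† ∘ t = idm M by apply: iso_unitary; exists t.
have ta : t ∘ a = a.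
  by rewrite /a compA tE -compA (compA (th _)) i1_nat compm1.
have tb : t ∘ b = b ∘ s.
  rewrite /b compA tE -!(compA (e 0%N)); congr (_ ∘ _).
  by rewrite compA i2_nat -(compA _ y) -(compA _ _ y) -scalel comp1m
             -[y in LHS]compm1 scaler scale_id.
pose c : K := (U a)^† ∘ U b.
suff cN : c = (- c)%R.
  have : (c * (1 + 1) = 0)%R by rewrite mulrDr mulr1 {1}cN addNr.
  move=> /eqP; rewrite mulf_eq0 => /orP[/eqP //|/eqP two0].
  by case/eqP: (oner_neq0 K); apply: (Pos_anti Pos1); rewrite (addr0_eq two0); exact: Pos1.
have abE : a^† ∘ b = a^† ∘ b ∘ s.
  by rewrite -compA -tb -{2}ta dagM -compA (compA t^†) tu comp1m.
have cE : c = U (a^† ∘ b) by rewrite (locFM HD _ b) locF_dag.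
by rewrite cE {1}abE (locFM HD (a^† ∘ b)) -sE scalar_mulE mulrN1.
Qed.

(** The map induced by the [m n] between the colimits is dagger monic, by [ax9_mono],
hence preserves norms. *)
Lemma colimit_mono_norm (Z W : nat -> D) (k : forall n, Z n ~> Z n.+1)
    (g : forall n, W n ~> W n.+1) (m : forall n, Z n ~> W n)
    L (d : forall n, Z n ~> L) M (e : forall n, W n ~> M) (z : rI ~> Z 0%N) :
  (forall n, epi (k n)) -> (forall n, epi (g n)) ->
  (forall n, m n.+1 ∘ k n = g n ∘ m n) -> (forall n, daggerMono (m n)) ->
  isColimit k d -> isColimit g e ->
  norm2 (U (e 0%N ∘ (m 0%N ∘ z))) = norm2 (U (d 0%N ∘ z)).
Proof.
move=> ek eg mn dm dd ee; have [_ dP] := dd; have [ec _] := ee.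
have [|h [hE _]] := dP M (fun n => e n ∘ m n).
  by move=> n; rewrite -compA mn compA ec.
have dh := ax9_mono HD ek eg mn dm dd ee hE.
rewrite (compA (e 0%N)) -hE -compA (locFM HD h) norm2_isom //.
exact: locF_isometry.
Qed.

(** The points [(x n, y)] of [X n ⊕ Y] have norms [p n + q]. Their images [Z n]
form a diagram whose colimit computes the infimum of these norms, and embeds
isometrically into the colimit [M] of [X n ⊕ Y]. The latter contains the
colimit of [X n] and [Y] as orthogonal summands. *)
Lemma isInfD_normalised (p : nat -> K) (q t : K) :
  (forall n, Pos (p n)) -> (forall n, p n != 0%R) ->
  (forall n, below (p n.+1) (p n)) -> Pos q -> (p 0%N + q = 1)%R ->
  isInf p t -> isInf (fun n => p n + q)%R (t + q)%R.
Proof.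
move=> Pp p0 dp Pq pq pt.
have Cp n : Con (p n).
  have [e Ce ->] := decreasing_below0 n dp; apply: ConM => //.
  by apply: Con_le1 => //; rewrite -pq addrC addKr.
have [Y [y yE]] : Con q by apply: Con_le1; rewrite // -pq addrK.
have pq0 n : (p n + q != 0)%R.
  apply: contra_neq (p0 n) => /eqP; rewrite addr_eq0 => /eqP pN.
  by apply: Pos_anti => //; rewrite pN opprK.
have [X [x [f [xE ex fx]]]] := decreasing_diagram Cp p0 dp.
have ef n : epi (f n) by apply: (@epi_of_comp _ _ _ _ (x n)); rewrite fx.
have epi1 (W : D) : epi (idm W) by move=> V h k; rewrite !compm1.
pose g n := f n ⊕m idm Y.
have eg n : epi (g n) by apply: epi_plusm.
have [L [c cc]] := ax9_colim HD ef; have [M [e ee]] := ax9_colim HD eg.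
(* [w 0] is an isometry by the normalisation, hence in [D]; then so is [w n]. *)
have exw n : exists w : rI ~> X n ⊕ Y, U w = lpair (U (x n)) (U y).
  elim: n => [|n [w wE]].
    have [|w wE] := @isometry_lift rI (X 0%N ⊕ Y) (lpair (U (x 0%N)) (U y)).
      by rewrite -[LHS]/(norm2 _) norm2_pair xE -yE pq.
    by exists w.
  by exists (g n ∘ w); rewrite (locFM HD _ w) wE plusm_lpair comp1m -locFM fx.
pose w n := projT1 (cid (exw n)).
have wE n : U (w n) = lpair (U (x n)) (U y) := projT2 (cid (exw n)).
have gw n : g n ∘ w n = w n.+1.
  apply: (@locF_inj _ HD).
  by rewrite (locFM HD (g n)) !wE plusm_lpair comp1m -locFM fx.
have wpq n : norm2 (U (w n)) = (p n + q)%R by rewrite wE norm2_pair xE -yE.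
have exZ n : exists Z (m : Z ~> X n ⊕ Y) (z : rI ~> Z),
    [/\ daggerMono m, w n = m ∘ z & epi z].
  by apply: point_image; rewrite wpq.
pose Z n := projT1 (cid (exZ n)).
have exm n : exists (m : Z n ~> X n ⊕ Y) (z : rI ~> Z n),
    [/\ daggerMono m, w n = m ∘ z & epi z] := projT2 (cid (exZ n)).
pose m n := projT1 (cid (exm n)).
have exz n : exists z : rI ~> Z n,
    [/\ daggerMono (m n), w n = m n ∘ z & epi z] := projT2 (cid (exm n)).
pose z n := projT1 (cid (exz n)).
have zP n : [/\ daggerMono (m n), w n = m n ∘ z n & epi (z n)] :=
  projT2 (cid (exz n)).
have dm n : daggerMono (m n) by have [] := zP n.
have wmz n : w n = m n ∘ z n by have [] := zP n.
have ez n : epi (z n) by have [] := zP n.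
pose k n := (m n.+1)^† ∘ g n ∘ m n.
have kz n : k n ∘ z n = z n.+1.
  by rewrite /k -!compA -wmz gw wmz compA dm comp1m.
have ek n : epi (k n) by apply: (@epi_of_comp _ _ _ _ (z n)); rewrite kz.
have mk n : m n.+1 ∘ k n = g n ∘ m n.
  by apply: (ez n); rewrite -(compA (m n.+1)) kz -(compA (g n)) -!wmz gw.
have [N [d dd]] := ax9_colim HD ek.
have zpq n : norm2 (U (z n)) = (p n + q)%R.
  by rewrite -wpq wmz (locFM HD (m n)) norm2_isom //; exact: locF_isometry.
have infz : isInf (fun n => p n + q)%R (norm2 (U (d 0%N ∘ z 0%N))).
  have := @colimit_isInf Z k N d z kz ez _ dd.
  rewrite (_ : (fun n => norm2 (U (z n))) = (fun n => p n + q)%R); last exact/funext.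
  by apply=> n; rewrite zpq.
have infx : isInf p (norm2 (U (c 0%N ∘ x 0%N))).
  have := @colimit_isInf X f L c x fx ex _ cc.
  rewrite (_ : (fun n => norm2 (U (x n))) = p); last exact/funext.
  by apply=> n; rewrite xE.
rewrite (isInf_uniq pt infx) yE.
suff <- : norm2 (U (d 0%N ∘ z 0%N)) =
    (norm2 (U (c 0%N ∘ x 0%N)) + norm2 (U y))%R by rewrite yE in infz.
rewrite -(colimit_mono_norm (z 0%N) ek eg mk dm dd ee) -wmz.
have nat1 n : i1 (X n.+1) Y ∘ f n = g n ∘ i1 (X n) Y by rewrite i1_nat.
have nat2 n : i2 (X n.+1) Y ∘ idm Y = g n ∘ i2 (X n) Y by rewrite i2_nat.
have d1 n : daggerMono (i1 (X n) Y) := P1_i1 HD (X n) Y.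
have d2 n : daggerMono (i2 (X n) Y) := P2_i2 HD (X n) Y.
(* [Y] is the colimit of the constant diagram, and [i2] a transformation from it. *)
have constY : isColimit (fun _ : nat => idm Y) (fun _ : nat => idm Y).
  split=> [n|V t' tc]; first exact: compm1.
  exists (t' 0%N); split=> [n|h hE]; last by rewrite -(hE 0%N) compm1.
  by elim: n => [|n IH]; [exact: compm1|rewrite IH -(tc n) compm1].
rewrite -(colimit_mono_norm (x 0%N) ef eg nat1 d1 cc ee).
rewrite -[y in RHS](comp1m y).
rewrite -(colimit_mono_norm y (fun _ => epi1 Y) eg nat2 d2 constY ee).
rewrite -norm2_ladd; last exact: (@colimit_orth X f Y M e).
congr norm2; rewrite (locFM HD _ (w 0%N)) wE lpairE laddMl -!locFM.
by [].
Qed.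

(** The normalisation [p 0 + q = 1] is achieved by scaling. *)
Lemma isInfD (p : nat -> K) (q t : K) :
  (forall n, Pos (p n)) -> (forall n, p n != 0%R) ->
  (forall n, below (p n.+1) (p n)) -> Pos q ->
  isInf p t -> isInf (fun n => p n + q)%R (t + q)%R.
Proof.
move=> Pp p0 dp Pq pt; pose c := (p 0%N + q)%R.
have c0 : c != 0%R.
  apply: contra_neq (p0 0%N) => /eqP; rewrite addr_eq0 => /eqP pN.
  by apply: Pos_anti => //; rewrite pN opprK.
have cV0 : c^-1%R != 0%R by rewrite invr_eq0.
have PcV : Pos c^-1%R by apply/PosV/PosD.
have := @isInfD_normalised (fun n => c^-1 * p n)%R (c^-1 * q)%R (c^-1 * t)%R.
move=> [|n|n||||H1 H2].
- by move=> n; apply: PosM.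
- by rewrite mulf_neq0.
- exact: belowM.
- exact: PosM.
- by rewrite -mulrDr mulVf.
- exact: isInfM.
have := isInfM c0 (conj H1 H2); rewrite -mulrDr mulVKf //; congr isInf.
by apply/funext => n; rewrite -mulrDr mulVKf.
Qed.

(** * The two orders agree *)

Lemma PosD_neq0 s t : Pos s -> Pos t -> s != 0%R -> (s + t != 0)%R.
Proof.
move=> Ps Pt; apply: contra_neq => /eqP; rewrite addr_eq0 => /eqP sN.
by apply: Pos_anti; rewrite // sN opprK.
Qed.

Lemma Con_ratio s t : Pos s -> Pos t -> (s + t != 0)%R -> Con (s / (s + t))%R.
Proof.
move=> Ps Pt st0; apply: Con_le1; first by apply: PosM => //; apply/PosV/PosD.
rewrite -[X in Pos (X - _)%R](divff st0) -mulrBl addrAC subrr add0r.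
by apply: PosM => //; apply/PosV/PosD.
Qed.

Lemma Pos_exp e n : Pos e -> Pos (e ^+ n)%R.
Proof.
by move=> Pe; elim: n => [|n IH]; [exact: Pos1|rewrite exprS; exact: PosM].
Qed.

Lemma below0 s : below s 0%R -> s = 0%R.
Proof. by move=> [e _ ->]; rewrite mulr0. Qed.

(** The infimum [t] satisfies [below (e^-1 * t) t]; were it nonzero, [e^-1] would be
contractive. *)
Lemma isInf_geometric e : Con e -> e != 0%R -> e != 1%R ->
  isInf (fun n => e ^+ n)%R 0%R.
Proof.
move=> Ce e0 e1.
have [|||t _ tI] := @isInf_exists (fun n => e ^+ n)%R.
- by move=> n; apply/Pos_exp/Con_Pos.
- by move=> n; rewrite expf_neq0.
- by move=> n; exists e; rewrite // exprS.
suff <- : t = 0%R by [].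
apply/eqP; apply: contraT => t0; case/eqP: e1; apply: Con_anti => //.
have [tn tP] := tI.
have [n|c Cc] := tP (e^-1 * t)%R.
  have [c Cc ->] := tn n.+1; exists c => //.
  by rewrite exprS mulrCA mulKf.
by move=> /(mulIf t0) ->.
Qed.

(** With [s n = 1 + e + ... + e ^ n], the identity
[(s n)^-1 + e = e ^ n.+1 * (s n)^-1 + 1] holds between two decreasing sequences.
The infimum on the right is [0 + 1], so that [1 - e] is the infimum of the
positive scalars [(s n)^-1]. *)
Lemma Con_ge0 e : Con e -> Pos (1 - e)%R.
Proof.
move=> Ce; have Pe := Con_Pos Ce.
have [->|e0] := eqVneq e 0%R; first by rewrite subr0; exact: Pos1.
have [->|e1] := eqVneq e 1%R; first by rewrite subrr; exact: Pos0.
pose s n : K := (\sum_(k < n.+1) e ^+ k)%R.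
have sS n : s n.+1 = (s n + e ^+ n.+1)%R by rewrite /s big_ord_recr.
have Ps n : Pos (s n).
  elim: n => [|n IH]; first by rewrite /s big_ord1; exact: Pos1.
  by rewrite sS; apply: PosD => //; exact: Pos_exp.
have s0 n : s n != 0%R.
  elim: n => [|n IH]; first by rewrite /s big_ord1 expr0; exact: oner_neq0.
  by rewrite sS; apply: PosD_neq0 => //; exact: Pos_exp.
pose u n := ((s n)^-1)%R; pose v n := (e ^+ n.+1 * u n)%R.
have Pu n : Pos (u n) by apply: PosV.
have u0 n : u n != 0%R by rewrite invr_eq0.
have v0 n : v n != 0%R by rewrite mulf_neq0 ?expf_neq0.
have Pv n : Pos (v n) by apply: PosM => //; exact: Pos_exp.
have du n : below (u n.+1) (u n).
  exists (s n / (s n + e ^+ n.+1))%R.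
    by apply: Con_ratio; rewrite -?sS //; exact: Pos_exp.
  by rewrite -sS mulrAC /u divff // mul1r.
have dv n : below (v n.+1) (v n).
  have [c Cc uE] := du n; exists (e * c)%R; first exact: ConM.
  by rewrite /v uE exprS mulrACA.
have uv n : (u n + e = v n + 1)%R.
  have -> : v n = ((1 + (e - 1) * s n) * u n)%R.
    by rewrite /s -subrX1 addrC subrK.
  by rewrite mulrDl mul1r -mulrA divff // mulr1 -addrA subrK.
have [t Pt tI] := isInf_exists Pu u0 du.
have [r Pr rI'] := isInf_exists Pv v0 dv.
have r0 : r = 0%R.
  apply: below0; have [_] := isInf_geometric Ce e0 e1; apply=> n.
  apply: below_trans (rI'.1 n) _; exists (e * u n)%R.
    apply: ConM => //; have [c Cc ->] := decreasing_below0 n du.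
    by rewrite /u /s big_ord1 expr0 invr1 mulr1.
  by rewrite /v exprS mulrAC.
have := isInfD Pu u0 du Pe tI.
rewrite (_ : (fun n => _) = (fun n => v n + 1)%R); last exact/funext.
move=> /isInf_uniq/(_ (isInfD Pv v0 dv Pos1 rI')); rewrite r0 add0r => <-.
by rewrite addrK.
Qed.

Lemma below_Pos_sub s t : Pos t -> below s t -> Pos (t - s)%R.
Proof.
move=> Pt [e Ce ->]; rewrite -{1}[t]mul1r -mulrBl.
by apply: PosM => //; exact: Con_ge0.
Qed.

Lemma Pos_sub_below s t : Pos s -> Pos (t - s)%R -> below s t.
Proof.
move=> Ps Pts; have tE : t = (s + (t - s))%R by rewrite addrC subrK.
have [s0|s0] := eqVneq s 0%R.
  by exists 0%R; rewrite ?mul0r //; apply: Con_le1; rewrite ?subr0;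
     [exact: Pos0|exact: Pos1].
have t0 : t != 0%R by rewrite tE; exact: PosD_neq0.
by exists (s / t)%R; [rewrite tE; apply: Con_ratio; rewrite -?tE|rewrite divfK].
Qed.

(** A sequence that reaches zero has infimum zero; otherwise [isInf_exists]
applies. *)
Lemma Pos_complete (p : nat -> K) :
  (forall n, Pos (p n)) -> (forall n, Pos (p n - p n.+1)%R) ->
  exists t, [/\ Pos t, forall n, Pos (p n - t)%R
    & forall s, Pos s -> (forall n, Pos (p n - s)%R) -> Pos (t - s)%R].
Proof.
move=> Pp dp; have [[n pn]|p0] := pselect (exists n, p n = 0%R).
  exists 0%R; split=> [|m|s Ps sp]; first exact: Pos0.
    by rewrite subr0.
  by have := sp n; rewrite pn.
have [|n|t Pt [tp tP]] := isInf_exists Pp.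
- by move=> n; apply/eqP => pn; apply: p0; exists n.
- exact: Pos_sub_below.
exists t; split=> [//|n|s Ps sp]; first exact: below_Pos_sub.
by apply: below_Pos_sub => //; apply: tP => n; exact: Pos_sub_below.
Qed.

End Norms.

(** * Fields with a complete positive cone *)

Section PositiveCone.
Variables (K : fieldType) (bar : K -> K) (P : K -> Prop).
Hypothesis barK : involutive bar.
Hypothesis barD : forall s t, bar (s + t) = bar s + bar t.
Hypothesis barM : forall s t, bar (s * t) = bar s * bar t.
Hypothesis PD : forall s t, P s -> P t -> P (s + t).
Hypothesis PM : forall s t, P s -> P t -> P (s * t).
Hypothesis P_bar : forall s, P s -> bar s = s.
Hypothesis P_sq : forall s, P (bar s * s).
Hypothesis P_anti : forall s, P s -> P (- s) -> s = 0.
Hypothesis P_complete : forall p : nat -> K,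
  (forall n, P (p n)) -> (forall n, P (p n - p n.+1)) ->
  exists t, [/\ P t, forall n, P (p n - t)
    & forall s, P s -> (forall n, P (p n - s)) -> P (t - s)].

Lemma bar0 : bar 0 = 0.
Proof. by apply: (addIr (bar 0)); rewrite -barD !add0r. Qed.

Lemma barN s : bar (- s) = - bar s.
Proof. by apply/eqP; rewrite -addr_eq0 -barD addNr bar0. Qed.

Lemma barB s t : bar (s - t) = bar s - bar t.
Proof. by rewrite barD barN. Qed.

Lemma bar1 : bar 1 = 1.
Proof.
have b0 : bar 1 != 0.
  by apply: contraNneq (oner_neq0 K) => b0; rewrite -(barK 1) b0 bar0.
by apply: (mulfI b0); rewrite -barM !mulr1.
Qed.

Lemma barV s : bar s^-1 = (bar s)^-1.
Proof.
have [->|s0] := eqVneq s 0; first by rewrite invr0 bar0 invr0.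
have b0 : bar s != 0 by apply: contraNneq s0 => b0; rewrite -(barK s) b0 bar0.
by apply: (mulfI b0); rewrite -barM !mulfV // bar1.
Qed.

Lemma P0 : P 0.
Proof. by have := P_sq 0; rewrite mulr0. Qed.

Lemma P1 : P 1.
Proof. by have := P_sq 1; rewrite mulr1 bar1. Qed.

Lemma P_sqr s : bar s = s -> P (s ^+ 2).
Proof. by move=> bs; rewrite expr2 -{1}bs. Qed.

Lemma PV s : P s -> P s^-1.
Proof.
move=> Ps; have [->|s0] := eqVneq s 0; first by rewrite invr0; exact: P0.
have -> : s^-1 = s * s^-1 ^+ 2 by field.
by apply: PM => //; apply: P_sqr; rewrite barV P_bar.
Qed.

(** For transporting positivity along an identity proved by [ring] or [field]. *)
Lemma PE s t : P s -> s = t -> P t.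
Proof. by move=> Ps <-. Qed.

Lemma P_nat n : P n%:R.
Proof. by elim: n => [|n IH]; [exact: P0|rewrite -natr1; exact: PD IH P1]. Qed.

Lemma natS_neq0 n : n.+1%:R != 0 :> K.
Proof.
apply: contra_neq (oner_neq0 K) => n0; apply: (P_anti P1).
by apply: PE (P_nat n) _; apply/eqP; rewrite -addr_eq0 natr1 n0.
Qed.

Lemma two_neq0 : 2 != 0 :> K. Proof. exact: natS_neq0. Qed.

Lemma P_half s : P s -> P (s / 2).
Proof. by move=> Ps; apply: PM => //; apply/PV/P_nat. Qed.

Lemma bar_nat n : bar n%:R = n%:R.
Proof. by apply: P_bar; exact: P_nat. Qed.

Lemma bar_int (z : int) : bar z%:~R = z%:~R.
Proof. by case: z => n; rewrite ?NegzE ?mulrNz ?barN bar_nat. Qed.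

(** An infimum [t] of the [1 / n] satisfies [2 t <= t]. *)
Lemma P_infinitesimal s : P s -> (forall n, P (n.+1%:R^-1 - s)) -> s = 0.
Proof.
move=> Ps sn.
have [|n|t [Pt tn tP]] := P_complete (p := fun n => n.+1%:R^-1).
- by move=> n; apply/PV/P_nat.
- apply: PE (PM (PV (P_nat n.+1)) (PV (P_nat n.+2))) _.
  have := natS_neq0 n; have := natS_neq0 n.+1; rewrite -(natr1 n.+1).
  by move: n.+1%:R => x x1 x0; field; rewrite x0 x1.
have t0 : t = 0.
  apply: P_anti => //; apply: PE (tP (2 * t) _ _) _; [|move=> n|by ring].
    exact: PM (P_nat 2) Pt.
  apply: PE (PM (P_nat 2) (tn (n * 2).+1%N)) _.
  have -> : ((n * 2).+2)%N%:R = 2 * n.+1%:R :> K by rewrite -natrM; congr _%:R; lia.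
  by have := natS_neq0 n; move: n.+1%:R => x x0; field; rewrite x0 two_neq0.
by apply: P_anti => //; apply: PE (tP s Ps sn) _; rewrite t0 sub0r.
Qed.

(** The square root is the limit of the decreasing iteration
[b |-> b - (b ^ 2 - c) / 2] from [1]. If [b] is the infimum then
[c <= b n * b m] for all [n] and [m] gives [c <= b ^ 2]; and the decrement is at
least [(b ^ 2 - c) / 2] at each step, which therefore vanishes. *)
Lemma P_sqrt c : P c -> P (1 - c) -> exists2 b, P b & b ^+ 2 = c.
Proof.
move=> Pc Pc1; pose b := fix b n : K :=
  if n is n'.+1 then b n' - (b n' ^+ 2 - c) / 2 else 1.
have bS n : b n.+1 = b n - (b n ^+ 2 - c) / 2 by [].
have inv n : [/\ P (b n), P (1 - b n) & P (b n ^+ 2 - c)].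
  elim: n => [|n [H1 H2 H3]].
    by split; [exact: P1|rewrite subrr; exact: P0|rewrite expr1n].
  rewrite bS; have Hd := P_half H3; split.
  - apply: PE (P_half (PD (PD (PM H1 H2) H1) Pc)) _.
    by field; exact: two_neq0.
  - by apply: PE (PD H2 Hd) _; ring.
  - apply: PE (PD (PM (PM (P_nat 2) Hd) H2) (P_sqr (P_bar Hd))) _.
    by field; exact: two_neq0.
have bb n m : P (b n * b m - c).
  wlog nm : n m / (n <= m)%N.
    by move=> H; case: (leqP n m) => [|/ltnW] /H //; rewrite mulrC.
  have [Hn _ _] := inv n; have [Hm _ Hc] := inv m.
  have dec : P (b n - b m).
    elim: m nm {Hm Hc} => [|m IH]; first by rewrite leqn0 => /eqP ->; rewrite subrr; exact: P0.
    rewrite leq_eqVlt => /orP[/eqP ->|/IH H]; first by rewrite subrr; exact: P0.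
    have [_ _ /P_half Hd] := inv m.
    by apply: PE (PD H Hd) _; rewrite bS; ring.
  by apply: PE (PD (PM dec Hm) Hc) _; ring.
have [|n|t [Pt tn tP]] := P_complete (p := b).
- by move=> n; have [] := inv n.
- have [_ _ /P_half Hd] := inv n; apply: PE Hd _; rewrite bS; ring.
exists t => //.
have below_inf x : P x -> (forall n, P (x * b n - c)) -> P (x * t - c).
  move=> Px xn; have [x0|x0] := eqVneq x 0.
    by have := xn 0%N; rewrite x0 !mul0r.
  have : P (t - c / x).
    apply: tP => [|n]; first exact/PM/PV.
    by apply: PE (PM (xn n) (PV Px)) _; field.
  by move=> /(PM Px) /PE; apply; field.
have ct : P (t ^+ 2 - c).
  rewrite expr2; apply: (below_inf) => // m; rewrite mulrC.
  by apply: below_inf => [|n]; [have [] := inv m|exact: bb].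
have d0 : (t ^+ 2 - c) / 2 = 0.
  apply: P_anti; first exact: P_half.
  apply: PE (tP (t + (t ^+ 2 - c) / 2) _ _) _; last by ring.
    exact/PD/P_half.
  move=> n; have [Hn _ _] := inv n.
  have tn1 := tn n.+1; rewrite bS in tn1.
  have sq : P (b n ^+ 2 - t ^+ 2).
    by apply: PE (PM (tn n) (PD Hn Pt)) _; ring.
  by apply: PE (PD tn1 (P_half sq)) _; field; exact: two_neq0.
apply/eqP; rewrite -subr_eq0; apply/eqP.
by apply: (mulIf (invr_neq0 two_neq0)); rewrite d0 mul0r.
Qed.

(** [s ^ 2] has a positive square root, and it is [s] or [- s]. *)
Lemma P_total_le1 s : P (1 - s) -> P (1 + s) -> P s \/ P (- s).
Proof.
move=> H1 H2.
have bs : bar s = s by have := P_bar H2; rewrite barD bar1 => /addrI.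
have [||b Pb bE] := @P_sqrt (s ^+ 2); first exact: P_sqr.
  by apply: PE (PM H1 H2) _; ring.
have /eqP := bE; rewrite eqf_sqr => /orP[] /eqP <-; first by left.
by right.
Qed.

(** The element [1 / (1 + a)] is comparable with each [1 / n.+1]. It is not below
all of them, since it would then vanish. *)
Lemma P_archimedean a : P a -> exists n, P (n%:R - a).
Proof.
move=> Pa; have Pa1 := PD P1 Pa.
have a1 : 1 + a != 0.
  apply: contra_neq (oner_neq0 K) => /addr0_eq a1.
  by apply: (P_anti P1); rewrite a1.
pose b := (1 + a)^-1; have Pb : P b := PV Pa1.
apply: contrapT => no; have /eqP : b = 0; last by rewrite invr_eq0 (negPf a1).
apply: P_infinitesimal => // n; have n0 := natS_neq0 n.
have [||H|] := @P_total_le1 (b - n.+1%:R^-1).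
- apply: PE (PD (PM Pa Pb) (PV (P_nat n.+1))) _.
  by move: n.+1%:R n0 => x x0; rewrite /b; field; rewrite a1 x0.
- apply: PE (PD (PM (P_nat n) (PV (P_nat n.+1))) Pb) _.
  by move: n0; rewrite -natr1 /b; move: n%:R => x x0; field; rewrite x0 a1.
- case: no; exists n; apply: PE (PM (PM (P_nat n.+1) Pa1) H) _.
  by move: n0; rewrite -natr1 /b; move: n%:R => x x0; field; rewrite x0 a1.
- by rewrite opprB.
Qed.

(** As the difference of the squares of [(s + 1) / 2] and [(s - 1) / 2], the
element [s] is bounded on both sides; divided by a bound it is subject to
[P_total_le1]. *)
Lemma P_total s : bar s = s -> P s \/ P (- s).
Proof.
move=> bs.
have P4 u : bar u = u -> P ((u / 2) ^+ 2).
  by move=> bu; apply: P_sqr; rewrite barM barV bar_nat bu.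
have Pa : P (((s + 1) / 2) ^+ 2) by apply: P4; rewrite barD bs bar1.
have Pa' : P (((s - 1) / 2) ^+ 2) by apply: P4; rewrite barB bs bar1.
have [n Hn] := P_archimedean Pa; have [n' Hn'] := P_archimedean Pa'.
have PN := P_nat (n + n').+1; have N0 := natS_neq0 (n + n').
have NE : (n + n').+1%:R = n%:R + n'%:R + 1 :> K by rewrite -natr1 natrD.
have [||H|H] := @P_total_le1 (s / (n + n').+1%:R).
- apply: PE (PM (PD (PD (PD Hn Pa') (P_nat n')) P1) (PV PN)) _.
  move: N0; rewrite NE; move: n%:R n'%:R => x x' N0.
  by field; rewrite two_neq0 N0.
- apply: PE (PM (PD (PD (PD Hn' Pa) (P_nat n)) P1) (PV PN)) _.
  move: N0; rewrite NE; move: n%:R n'%:R => x x' N0.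
  by field; rewrite two_neq0 N0.
- by left; apply: PE (PM H PN) _; rewrite divfK.
- by right; apply: PE (PM H PN) _; rewrite mulNr divfK.
Qed.

Lemma P_int_ge0 (z : int) : P z%:~R -> 0 <= z.
Proof.
case: z => // n Pn; have := P_anti Pn.
rewrite NegzE mulrNz opprK -pmulrn => /(_ (P_nat _)) /eqP.
by rewrite oppr_eq0 (negPf (natS_neq0 n)).
Qed.

Lemma P_floor x : bar x = x ->
  exists z : int, P (x - z%:~R) /\ P ((z + 1)%:~R - x).
Proof.
have nonneg y : P y -> exists z : int, P (y - z%:~R) /\ P ((z + 1)%:~R - y).
  move=> Py; have [n] := P_archimedean Py; elim: n => [|n IH] Hn.
    exists 0; split; first by rewrite subr0.
    by apply: PE (PD P1 Hn) _; rewrite add0r.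
  have [|H|H] := @P_total (y - n%:R); first by rewrite barB (P_bar Py) bar_nat.
    exists n%:Z; split=> //; apply: PE Hn _.
    by rewrite rmorphD -natr1.
  by apply: IH; rewrite -opprB.
move=> bx; have [Px|Nx] := P_total bx; first exact: nonneg.
have [z [H1 H2]] := nonneg _ Nx; exists (- z - 1); rewrite subrK; split.
  by apply: PE H2 _; rewrite !rmorphD !rmorphN /=; ring.
by apply: PE H1 _; rewrite rmorphN /=; ring.
Qed.

(** * The isomorphism with the real numbers *)

Section ToReals.
Variable R : realType.

(** The real number with the same lower cut of fractions as [a]. *)
Definition toReal (a : K) : R :=
  sup [set r : R | exists (z : int) (n : nat),
    r = z%:~R / n.+1%:R /\ P (n.+1%:R * a - z%:~R)].

Lemma cut_le (a : K) (z z' : int) n n' :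
  P (n.+1%:R * a - z%:~R) -> P (z'%:~R - n'.+1%:R * a) ->
  z%:~R / n.+1%:R <= z'%:~R / n'.+1%:R :> R.
Proof.
move=> Hz Hz'.
rewrite ler_pdivrMr ?ltr0Sn // mulrAC ler_pdivlMr ?ltr0Sn //.
rewrite -[n.+1%:R]/(n.+1%:Z%:~R) -[n'.+1%:R]/(n'.+1%:Z%:~R) -!intrM ler_int.
rewrite -subr_ge0; apply: P_int_ge0.
apply: PE (PD (PM (P_nat n'.+1) Hz) (PM (P_nat n.+1) Hz')) _.
by rewrite rmorphB !rmorphM /= -!pmulrn; ring.
Qed.

Lemma toReal_ge (a : K) (z : int) n : bar a = a ->
  P (n.+1%:R * a - z%:~R) -> z%:~R / n.+1%:R <= toReal a.
Proof.
move=> ba Hz; apply: ub_le_sup; last by exists z, n.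
have [z' [_ Hz']] := P_floor ba.
exists ((z' + 1)%:~R / 1%:R) => _ [w [m [-> Hw]]].
by apply: (cut_le (n' := 0) Hw); rewrite mul1r.
Qed.

Lemma toReal_le (a : K) (z : int) n : bar a = a ->
  P (z%:~R - n.+1%:R * a) -> toReal a <= z%:~R / n.+1%:R.
Proof.
move=> ba Hz; apply: ge_sup; last by move=> _ [w [m [-> Hw]]]; exact: cut_le Hw Hz.
have [z' [Hz' _]] := P_floor ba.
by exists (z'%:~R / 1%:R), z', 0; rewrite mul1r.
Qed.

Lemma toReal_int (z : int) : toReal z%:~R = z%:~R.
Proof.
apply/eqP; rewrite eq_le -[X in _ <= X]divr1 -[X in _ && (X <= _)]divr1.
by rewrite (@toReal_le _ z 0) ?(@toReal_ge _ z 0) ?bar_int // mul1r subrr; exact: P0.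
Qed.

(** After multiplication by [n.+1], both real numbers are within a bounded
distance of the floor of [n.+1 * a], and [n] is arbitrary. *)
Lemma toReal_eq (a : K) (r : R) (c : nat) : bar a = a ->
  (forall (n : nat) (z : int),
     P (n.+1%:R * a - z%:~R) -> P ((z + 1)%:~R - n.+1%:R * a) ->
     `|n.+1%:R * r - z%:~R| <= c%:R) ->
  toReal a = r.
Proof.
move=> ba H; apply/eqP; rewrite -subr_eq0 -normr_le0 leNgt; apply/negP => d0.
set d := `|_| in d0.
have [n Hn] : exists n, (c + 1)%:R < n%:R * d.
  exists (Num.truncn ((c + 1)%:R / d)).+1.
  by rewrite -ltr_pdivrMr // truncnS_gt.
have [z [H1 H2]] : exists z : int, P (n.+1%:R * a - z%:~R) /\ P ((z + 1)%:~R - n.+1%:R * a).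
  by apply: P_floor; rewrite barM bar_nat ba.
have := H n z H1 H2; have := toReal_ge ba H1; have := toReal_le ba H2.
rewrite ler_pdivlMr ?ltr0Sn // ler_pdivrMr ?ltr0Sn // => h1 h2 h3.
have : n.+1%:R * d <= (c + 1)%:R.
  rewrite /d -[X in X * _]gtr0_norm ?ltr0Sn // -normrM.
  have -> : n.+1%:R * (toReal a - r) =
      (toReal a * n.+1%:R - z%:~R) - (n.+1%:R * r - z%:~R) by ring.
  apply: le_trans (ler_normB _ _) _; rewrite natrD addrC; apply: lerD => //.
  rewrite ger0_norm ?subr_ge0 // lerBlDl; apply: le_trans h1 _.
  by rewrite rmorphD.
apply/negP; rewrite -ltNge; apply: lt_le_trans Hn _.
by rewrite ler_pM2r // ler_nat.
Qed.

Lemma toReal_ge0 a : P a -> 0 <= toReal a.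
Proof.
move=> Pa; have := @toReal_ge a 0 0 (P_bar Pa); rewrite mul0r; apply.
by rewrite mul1r subr0.
Qed.

Lemma toRealD a b : bar a = a -> bar b = b -> toReal (a + b) = toReal a + toReal b.
Proof.
move=> ba bb; apply: (@toReal_eq _ _ 3); first by rewrite barD ba bb.
(* The floors satisfy [u + v - 1 <= z <= u + v + 2], whence an error of at most 3. *)
move=> n z H1 H2.
have floor x : bar x = x -> exists w : int, [/\ P (n.+1%:R * x - w%:~R),
    P ((w + 1)%:~R - n.+1%:R * x),
    w%:~R <= n.+1%:R * toReal x & n.+1%:R * toReal x <= (w + 1)%:~R].
  move=> bx; have [w [Hw1 Hw2]] : exists w : int,
      P (n.+1%:R * x - w%:~R) /\ P ((w + 1)%:~R - n.+1%:R * x).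
    by apply: P_floor; rewrite barM bar_nat bx.
  exists w; split=> //.
    by rewrite mulrC -ler_pdivrMr ?ltr0Sn //; exact: toReal_ge.
  by rewrite mulrC -ler_pdivlMr ?ltr0Sn //; exact: toReal_le.
have [u [u1 u2 u3 u4]] := floor a ba; have [v [v1 v2 v3 v4]] := floor b bb.
have l1 : 0 <= z + 1 - (u + v).
  apply: P_int_ge0; apply: PE (PD H2 (PD u1 v1)) _.
  by rewrite !(rmorphD, rmorphN) /=; ring.
have l2 : 0 <= u + 1 + (v + 1) - z.
  apply: P_int_ge0; apply: PE (PD H1 (PD u2 v2)) _.
  by rewrite !(rmorphD, rmorphN) /=; ring.
move: l1 l2; rewrite -!(ler_int R) !(rmorphD, rmorphN) /= => l1 l2.
move: u4 v4; rewrite !rmorphD /= => u4 v4.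
by rewrite ler_norml mulrDr; apply/andP; split; lra.
Qed.

Lemma toReal0 : toReal 0 = 0. Proof. exact: (toReal_int 0). Qed.
Lemma toReal1 : toReal 1 = 1. Proof. exact: (toReal_int 1). Qed.

Lemma toRealN a : bar a = a -> toReal (- a) = - toReal a.
Proof.
move=> ba; apply/eqP; rewrite -addr_eq0 -toRealD ?barN ?ba //.
by rewrite addNr toReal0.
Qed.

Lemma toRealB a b : bar a = a -> bar b = b -> toReal (a - b) = toReal a - toReal b.
Proof. by move=> ba bb; rewrite toRealD ?barN ?bb // toRealN. Qed.

Lemma toReal_mono a b : bar a = a -> bar b = b -> P (b - a) -> toReal a <= toReal b.
Proof. by move=> ba bb /toReal_ge0; rewrite toRealB // subr_ge0. Qed.

Lemma toReal_eq0 a : bar a = a -> toReal a = 0 -> a = 0.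
Proof.
have pos b : P b -> toReal b = 0 -> b = 0.
  move=> Pb b0; apply/eqP; apply: contraT => nb.
  have [n Hn] := P_archimedean (PV Pb).
  have : P (n.+1%:R * b - 1%:~R).
    by apply: PE (PD (PM Pb Hn) Pb) _; rewrite -natr1; field.
  move=> /(toReal_ge (P_bar Pb)); rewrite b0 leNgt.
  by rewrite divr_gt0 ?ltr0Sn // ltr01.
move=> ba; have [Pa|Na] := P_total ba; first exact: pos.
move=> a0; apply/eqP; rewrite -oppr_eq0; apply/eqP; apply: pos => //.
by rewrite toRealN // a0 oppr0.
Qed.

Lemma toReal_inj a b : bar a = a -> bar b = b -> toReal a = toReal b -> a = b.
Proof.
move=> ba bb ab; apply/eqP; rewrite -subr_eq0; apply/eqP; apply: toReal_eq0.
  by rewrite barB ba bb.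
by rewrite toRealB // ab subrr.
Qed.

Lemma P_toReal a : bar a = a -> 0 <= toReal a -> P a.
Proof.
move=> ba a0; have [//|Na] := P_total ba.
have := toReal_ge0 Na; rewrite toRealN // oppr_ge0 => a0'.
have -> : a = 0 by apply: toReal_eq0 => //; apply/eqP; rewrite eq_le a0 a0'.
exact: P0.
Qed.

Lemma toRealMz (z : int) a : bar a = a -> toReal (z%:~R * a) = z%:~R * toReal a.
Proof.
have nat n b : bar b = b -> toReal (n%:R * b) = n%:R * toReal b.
  move=> bb; elim: n => [|n IH]; first by rewrite !mul0r toReal0.
  by rewrite -!natr1 !mulrDl !mul1r toRealD ?IH // barM bar_nat bb.
move=> ba; case: z => n; first exact: nat.
by rewrite NegzE !mulrNz !mulNr toRealN ?nat // barM bar_nat ba.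
Qed.

(** For [b] positive, [a |-> toReal (a * b) / toReal b] is additive, monotone and
preserves one; integer bounds on multiples of [a] leave no choice for it. *)
Lemma toRealM a b : bar a = a -> bar b = b -> toReal (a * b) = toReal a * toReal b.
Proof.
move=> ba; have posM c : P c -> toReal (a * c) = toReal a * toReal c.
  move=> Pc; have [->|c0] := eqVneq c 0; first by rewrite mulr0 toReal0 mulr0.
  have bc := P_bar Pc.
  have tc : 0 < toReal c.
    by rewrite lt_def toReal_ge0 // andbT; apply: contra_neq c0; exact: toReal_eq0.
  suff -> : toReal a = toReal (a * c) / toReal c by rewrite divfK // gt_eqF.
  apply: (@toReal_eq _ _ 1) => // n z H1 H2.
  have bna : bar (n.+1%:R * (a * c)) = n.+1%:R * (a * c).
    by rewrite !barM bar_nat ba bc.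
  have bz w : bar (w%:~R * c) = w%:~R * c by rewrite barM bar_int bc.
  have m1 : z%:~R * toReal c <= n.+1%:R * toReal (a * c).
    rewrite -toRealMz // (pmulrn _ n.+1) -toRealMz; last by rewrite barM ba bc.
    by apply: toReal_mono => //; apply: PE (PM H1 Pc) _; rewrite -pmulrn; ring.
  have m2 : n.+1%:R * toReal (a * c) <= (z + 1)%:~R * toReal c.
    rewrite -toRealMz // (pmulrn _ n.+1) -toRealMz; last by rewrite barM ba bc.
    by apply: toReal_mono => //; apply: PE (PM H2 Pc) _; rewrite -pmulrn; ring.
  rewrite ler_distl mulrA ler_pdivrMr // rmorphD /= in m2 *; rewrite m2 andbT.
  apply: le_trans (_ : z%:~R <= _); first by rewrite lerBlDr lerDl.
  by rewrite ler_pdivlMr.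
move=> bb; have [/posM //|/posM] := P_total bb.
by rewrite mulrN !toRealN ?barM ?ba ?bb // mulrN => /oppr_inj.
Qed.

Lemma toReal_nat n : toReal n%:R = n%:R. Proof. exact: (toReal_int n). Qed.

Lemma toReal_frac m d : (0 < d)%N -> toReal (m%:R / d%:R) = m%:R / d%:R.
Proof.
case: d => // d _; have d0 : d.+1%:R != 0 :> R by rewrite pnatr_eq0.
have dK := natS_neq0 d; apply: (mulIf d0); rewrite divfK // -[X in _ * X]toReal_nat.
by rewrite -toRealM ?barM ?barV ?bar_nat // divfK // toReal_nat.
Qed.

(** A nonnegative [r] is the limit of the decreasing sequence of its dyadic upper
approximations, whose infimum in [K] is also above the lower approximations. *)
Lemma toReal_surj_ge0 (r : R) : 0 <= r -> exists2 a, P a & toReal a = r.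
Proof.
move=> r0; pose k n := Num.truncn (r * (2 ^ n)%:R).
have e0 n : (0 < 2 ^ n)%N by rewrite expn_gt0.
have eR n : 0 < (2 ^ n)%:R :> R by rewrite ltr0n.
have kr n : (k n)%:R / (2 ^ n)%:R <= r.
  by rewrite ler_pdivrMr // truncn_le // mulr_ge0 // ltW.
have rk n : r <= (k n).+1%:R / (2 ^ n)%:R.
  by rewrite ler_pdivlMr // ltW // truncnS_gt.
pose s n : K := (k n)%:R / (2 ^ n)%:R; pose p n : K := (k n).+1%:R / (2 ^ n)%:R.
have Pf m d : P (m%:R / d%:R) by apply: PM (P_nat m) (PV (P_nat d)).
have le_P x y : P x -> P y -> toReal x <= toReal y -> P (y - x).
  move=> /P_bar bx /P_bar b_y xy; apply: P_toReal; first by rewrite barB bx b_y.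
  by rewrite toRealB // subr_ge0.
have [n|n|t [Pt tp tP]] := @P_complete p; first exact: Pf.
  apply: le_P; rewrite ?toReal_frac //; try exact: Pf.
  rewrite ler_pdivlMr // mulrAC ler_pdivrMr // expnS -!natrM ler_nat.
  have : (k n.+1)%:R < (2 * (k n).+1)%:R :> R.
    apply: le_lt_trans (_ : r * (2 ^ n.+1)%:R < _).
      by rewrite truncn_le // mulr_ge0 // ltW.
    rewrite expnS !natrM mulrCA ltr_pM2l ?ltr0n //.
    exact: truncnS_gt.
  by rewrite ltr_nat => H; rewrite mulnA leq_mul2r (mulnC _ 2) H orbT.
exists t => //; have bt := P_bar Pt.
have ub n : toReal t <= r + (2 ^ n)%:R^-1.
  apply: le_trans (_ : toReal (p n) <= _).
    by apply: toReal_mono; rewrite // P_bar //; exact: Pf.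
  by rewrite toReal_frac // -natr1 mulrDl mul1r lerD2r.
have lb n : r - (2 ^ n)%:R^-1 <= toReal t.
  apply: le_trans (_ : toReal (s n) <= _).
    by rewrite toReal_frac // lerBlDr -[X in _ + X]mul1r -mulrDl natr1.
  apply: toReal_mono => //; first exact/P_bar/Pf.
  apply: tP => [|m]; first exact: Pf.
  apply: le_P; try exact: Pf.
  by rewrite !toReal_frac //; exact: le_trans (kr n) (rk m).
apply/eqP; rewrite -subr_eq0 -normr_le0 leNgt; apply/negP => d0.
set d := `|_| in d0; pose n := (Num.truncn d^-1).+1.
have : d <= (2 ^ n)%:R^-1 by rewrite ler_distl ub lb.
apply/negP; rewrite -ltNge invf_plt ?posrE //.
apply: lt_le_trans (truncnS_gt _) _; rewrite ler_nat.
exact/ltnW/ltn_expl.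
Qed.

Lemma toReal_surj (r : R) : exists2 a, bar a = a & toReal a = r.
Proof.
have [r0|/ltW r0] := leP 0 r.
  by have [a /P_bar ba ar] := toReal_surj_ge0 r0; exists a.
have [|a /P_bar ba ar] := @toReal_surj_ge0 (- r); first by rewrite oppr_ge0.
by exists (- a); rewrite ?barN ?ba // toRealN // ar opprK.
Qed.

(** * The isomorphism with the complex numbers *)

Section Complex.
Variable j : K.
Hypothesis j2 : j * j = -1.
Hypothesis bar_j : bar j = - j.

Definition re s : K := (s + bar s) / 2.
Definition im s : K := (s - bar s) / (2 * j).

Lemma j_neq0 : j != 0.
Proof.
apply: contraNneq (oner_neq0 K) => j0.
by rewrite -oppr_eq0 -j2 j0 mul0r.
Qed.

Lemma bar_re s : bar (re s) = re s.
Proof. by rewrite /re barM barV bar_nat barD barK addrC. Qed.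

Lemma bar_im s : bar (im s) = im s.
Proof.
have := j_neq0; have := two_neq0.
rewrite /im barM barV barM bar_nat bar_j barB barK => h1 h2.
by field; rewrite oppr_eq0 h1 h2.
Qed.

Lemma re_im s : re s + j * im s = s.
Proof.
have := j_neq0; have := two_neq0 => h1 h2; rewrite /re /im.
by field; rewrite h1 h2.
Qed.

Lemma re_im_uniq a b : bar a = a -> bar b = b -> re (a + j * b) = a /\ im (a + j * b) = b.
Proof.
move=> ba bb; have h2 := j_neq0; have h1 := two_neq0.
rewrite /re /im barD barM ba bb bar_j; split; first by field; rewrite h1.
by field; rewrite h1 h2.
Qed.

Definition toComplex s : R[i] := toReal (re s) +i* toReal (im s).

Lemma toComplexE a b : bar a = a -> bar b = b ->
  toComplex (a + j * b) = toReal a +i* toReal b.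
Proof. by move=> ba bb; have [rE iE] := re_im_uniq ba bb; rewrite /toComplex rE iE. Qed.

Lemma toComplexD s t : toComplex (s + t) = toComplex s + toComplex t.
Proof.
rewrite -{1}(re_im s) -{1}(re_im t) addrACA -mulrDr.
by rewrite toComplexE ?toRealD ?barD ?bar_re ?bar_im.
Qed.

Lemma toComplexM s t : toComplex (s * t) = toComplex s * toComplex t.
Proof.
have -> : s * t = (re s * re t - im s * im t) + j * (re s * im t + im s * re t).
  rewrite -{1}(re_im s) -{1}(re_im t).
  transitivity (re s * re t + (j * j) * (im s * im t)
    + j * (re s * im t + im s * re t)); first by ring.
  by rewrite j2 mulN1r.
rewrite [X in _ = X * _]/toComplex [X in _ = _ * X]/toComplex.
move: (bar_re s) (bar_im s) (bar_re t) (bar_im t).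
move: (re s) (im s) (re t) (im t) => a b c d ba bb bc bd.
rewrite toComplexE ?barB ?barD ?barM ?ba ?bb ?bc ?bd //.
by rewrite toRealB ?toRealD ?toRealM ?barM ?ba ?bb ?bc ?bd.
Qed.

Lemma toComplex_bar s : toComplex (bar s) = conjc (toComplex s).
Proof.
have -> : bar s = re s + j * - im s.
  by rewrite -{1}(re_im s) barD barM bar_j bar_re bar_im mulrN mulNr.
by rewrite toComplexE ?barN ?bar_re ?bar_im // toRealN ?bar_im.
Qed.

Lemma toComplex_fixed s : bar s = s -> toComplex s = (toReal s)%:C.
Proof.
move=> bs; rewrite -[s in LHS]addr0 -(mulr0 j) toComplexE ?bar0 //.
by rewrite toReal0.
Qed.

Lemma toComplex_inj : injective toComplex.
Proof.
move=> s t [/toReal_inj r_eq /toReal_inj i_eq].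
by rewrite -(re_im s) -(re_im t) r_eq ?bar_re // i_eq ?bar_im.
Qed.

Lemma toComplex_surj (z : R[i]) : exists s, toComplex s = z.
Proof.
case: z => x y; have [a ba ax] := toReal_surj x; have [b bb b_y] := toReal_surj y.
by exists (a + j * b); rewrite toComplexE // ax b_y.
Qed.

End Complex.

(** A nonzero [w] with [bar w = - w] has [- w ^ 2] positive, and [w] divided by
the square root of [- w ^ 2] squares to [-1]. *)
Lemma exists_imaginary_unit z : bar z <> z -> exists j, j * j = -1 /\ bar j = - j.
Proof.
move=> bz; pose w := z - bar z.
have w0 : w != 0 by rewrite subr_eq0; apply/eqP => zb; apply: bz.
have bw : bar w = - w by rewrite barB barK opprB.
have Pw : P (- (w * w)) by rewrite -mulNr -bw.
have [r br rE] := toReal_surj (Num.sqrt (toReal (- (w * w)))).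
have rr : r * r = - (w * w).
  apply: toReal_inj; rewrite ?(P_bar Pw) ?barM ?br //.
  by rewrite toRealM // rE -expr2 sqr_sqrtr // toReal_ge0.
have r0 : r != 0.
  apply: contraNneq w0 => r0; move: rr; rewrite r0 mul0r => /eqP.
  by rewrite eq_sym oppr_eq0 mulf_eq0 orbb.
exists (w / r); rewrite barM barV br bw mulNr; split=> //.
by rewrite mulrACA -invfM rr invrN mulrN divff // mulf_neq0.
Qed.

End ToReals.

Lemma bijective_of (T : Type) (f : K -> T) :
  injective f -> (forall y, exists x, f x = y) -> bijective f.
Proof.
move=> fI fS; pose g y := projT1 (cid (fS y)).
have gK y : f (g y) = y := projT2 (cid (fS y)).
by exists g => // x; apply: fI.
Qed.

(** The involution is either trivial, and [toReal] is the isomorphism, or it moves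
an element, and [toComplex] is the isomorphism for the imaginary unit that this
element provides. *)
Theorem positive_cone_real_or_complex (R : realType) :
  (exists phi : K -> R, [/\ bijective phi, phi 1 = 1,
     {morph phi : s t / s + t}, {morph phi : s t / s * t}
     & forall s, phi (bar s) = phi s] /\
     phi @` [set s | P s] = [set r : R | 0 <= r]) \/
  (exists phi : K -> R[i], [/\ bijective phi, phi 1 = 1,
     {morph phi : s t / s + t}, {morph phi : s t / s * t}
     & forall s, phi (bar s) = conjc (phi s)] /\
     phi @` [set s | P s] = [set r%:C | r in [set r : R | 0 <= r]]).
Proof.
have [triv|/existsNP[z bz]] := pselect (forall s, bar s = s); [left|right].
  exists (@toReal R); split; first split.
  - apply: bijective_of => [s t|r]; first exact: toReal_inj.
    by have [a _ ar] := toReal_surj r; exists a.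
  - exact: toReal1.
  - by move=> s t; apply: toRealD.
  - by move=> s t; apply: toRealM.
  - by move=> s; rewrite triv.
  apply/seteqP; split=> [_ [s /= Ps <-]|r /= r0]; first exact: toReal_ge0.
  by have [a Pa ar] := toReal_surj_ge0 r0; exists a.
have [j [j2 bj]] := exists_imaginary_unit R bz.
exists (toComplex R j); split; first split.
- apply: bijective_of => [|y]; first exact: toComplex_inj.
  exact: toComplex_surj.
- by rewrite toComplex_fixed ?bar1 // toReal1.
- exact: toComplexD.
- exact: toComplexM.
- exact: toComplex_bar.
apply/seteqP; split=> [_ [s /= Ps <-]|_ [r /= r0 <-]].
  exists (toReal R s); first exact: toReal_ge0.
  by rewrite toComplex_fixed // P_bar.
have [a Pa ar] := toReal_surj_ge0 r0; exists a => //.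
by rewrite toComplex_fixed ?ar // P_bar.
Qed.

End PositiveCone.

Theorem corollary51 (R : realType) (D : daggerRig) (HD : conditions D) :
  (exists phi : scalars HD -> R,
     involutiveFieldIso (fun r : R => r) phi /\
     phi @` positiveScalars HD = [set r : R | 0 <= r]) \/
  (exists phi : scalars HD -> R[i],
     involutiveFieldIso (@conjc R) phi /\
     phi @` positiveScalars HD = [set r%:C | r in [set r : R | 0 <= r]]).
Proof.
have [] := @positive_cone_real_or_complex (scalarField HD) (@sconj D HD) (@Pos D HD)
  (@sconjK D HD) (@sconjD D HD) (@sconjM D HD) (@PosD D HD) (@PosM D HD)
  (@Pos_conj D HD) (@Pos_sq D HD) (@Pos_anti D HD) (@Pos_complete D HD) R.
- move=> [phi [[phiB phi1 phiD phiM phiC] phiP]]; left; exists phi.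
  by split; [split|].
- move=> [phi [[phiB phi1 phiD phiM phiC] phiP]]; right; exists phi.
  by split; [split|].
Qed.
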